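(* For any $k\in\mathbb{Z}$, $\mathcal{H}'_{\langle k\rangle}$ is an irreducible $osp(2n+1|2m)$-module. Moreover, $\mathcal{B}=\bigoplus_{\ell\in\mathbb{N},\,k\in\mathbb{Z}}(\eta')^\ell(\mathcal{H}'_{\langle k\rangle})$ is a direct sum of irreducible $osp(2n+1|2m)$-submodules.
   Context: Fix positive integers $n,m$ and integers $n_1,n_2$ with $1\le n_1$, $n_1+1<n_2\le n$. Let $\mathcal{B}$ be the complex supercommutative polynomial algebra in even variables $x_0,x_1,\dots,x_n,y_1,\dots,y_n$ and odd variables $\theta_1,\dots,\theta_m,\vartheta_1,\dots,\vartheta_m$, with partial derivatives and odd derivations $\partial_{\theta_r},\partial_{\vartheta_r}$ (super Leibniz rule). Let $\rho$ be the representation of $osp(2n+1|2m)\subset gl(2n+1|2m)$ (indices $0,\dots,2n$ even, $2n+1,\dots,2n+2m$ odd) on $\mathcal{B}$ given on a spanning set by ($i,j\in\{1..n\}$, $r,s\in\{1..m\}$): $E_{i,j}-E_{n+j,n+i}\mapsto x_i\partial_{x_j}-y_j\partial_{y_i}$; $E_{2n+r,2n+s}-E_{2n+m+s,2n+m+r}\mapsto\theta_r\partial_{\theta_s}-\vartheta_s\partial_{\vartheta_r}$; $E_{i,2n+r}-E_{2n+m+r,n+i}\mapsto x_i\partial_{\theta_r}-\vartheta_r\partial_{y_i}$; $E_{2n+r,i}+E_{n+i,2n+m+r}\mapsto\theta_r\partial_{x_i}+y_i\partial_{\vartheta_r}$; ($i<j$) $E_{i,n+j}-E_{j,n+i}\mapsto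 x_i\partial_{y_j}-x_j\partial_{y_i}$, $E_{n+i,j}-E_{n+j,i}\mapsto y_i\partial_{x_j}-y_j\partial_{x_i}$; ($r\le s$) $E_{2n+m+r,2n+s}+E_{2n+m+s,2n+r}\mapsto\vartheta_r\partial_{\theta_s}+\vartheta_s\partial_{\theta_r}$, $E_{2n+r,2n+m+s}+E_{2n+s,2n+m+r}\mapsto\theta_r\partial_{\vartheta_s}+\theta_s\partial_{\vartheta_r}$; $E_{i,2n+m+r}+E_{2n+r,n+i}\mapsto x_i\partial_{\vartheta_r}+\theta_r\partial_{y_i}$; $E_{n+i,2n+r}-E_{2n+m+r,i}\mapsto y_i\partial_{\theta_r}-\vartheta_r\partial_{x_i}$; $E_{0,i}-E_{n+i,0}\mapsto x_0\partial_{x_i}-y_i\partial_{x_0}$; $E_{0,n+i}-E_{i,0}\mapsto x_0\partial_{y_i}-x_i\partial_{x_0}$; $E_{0,2n+r}-E_{2n+m+r,0}\mapsto x_0\partial_{\theta_r}-\vartheta_r\partial_{x_0}$; $E_{0,2n+m+r}+E_{2n+r,0}\mapsto x_0\partial_{\vartheta_r}+\theta_r\partial_{x_0}$. Let $\sigma$ be the automorphism of the algebra of polynomial-coefficient differential operators on $\mathcal{B}$ with $\sigma(x_r)=\partial_{x_r}$, $\sigma(\partial_{x_r})=-x_r$ for $1\le r\le n_1$, $\sigma(y_s)=\partial_{y_s}$, $\sigma(\partial_{y_s})=-y_s$ for $s>n_2$, fixing all other generators (operators composed in the order written). The representation considered is $\xi\mapsto\sigma(\rho(\xi))$. Let $\Delta=-\sum_{i=1}^{n_1}x_i\partial_{y_i}+\sum_{r=n_1+1}^{n_2}\partial_{x_r}\partial_{y_r}-\sum_{s=n_2+1}^ny_s\partial_{x_s}+\sum_{r=1}^m\partial_{\theta_r}\partial_{\vartheta_r}$,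 $\eta=\sum_{i=1}^{n_1}y_i\partial_{x_i}+\sum_{r=n_1+1}^{n_2}x_ry_r+\sum_{s=n_2+1}^nx_s\partial_{y_s}+\sum_{r=1}^m\theta_r\vartheta_r$, $\Delta'=\partial_{x_0}^2+2\Delta$, $\eta'=x_0^2+2\eta$ (operators). Let $\mathcal{A}\subset\mathcal{B}$ be the subalgebra not involving $x_0$; for $j\in\mathbb{Z}$, $\mathcal{A}_{\langle j\rangle}$ is the span of monomials $x^\alpha y^\beta\theta_{i_1}\cdots\theta_{i_a}\vartheta_{j_1}\cdots\vartheta_{j_b}$ in $\mathcal{A}$ with $\sum_{r=n_1+1}^n\alpha_r-\sum_{i=1}^{n_1}\alpha_i+\sum_{i=1}^{n_2}\beta_i-\sum_{r=n_2+1}^n\beta_r+a+b=j$. For $k\in\mathbb{Z}$, $\mathcal{B}_{\langle k\rangle}=\sum_{i=0}^\infty\mathcal{A}_{\langle k-i\rangle}x_0^i$ and $\mathcal{H}'_{\langle k\rangle}=\{f\in\mathcal{B}_{\langle k\rangle}\mid\Delta'(f)=0\}$. *)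

(* Defs.v *)
From mathcomp Require Import all_boot all_algebra.
From mathcomp Require Import mpoly.
From mathcomp Require Import complex.
From mathcomp Require Import Rstruct.

Set Implicit Arguments.
Unset Strict Implicit.
Unset Printing Implicit Defensive.
Import GRing.Theory.
Local Open Scope ring_scope.

Definition CC := complex Rdefinitions.R.

(* Even variables are indexed by 'I_(n+n).+1 :                              *)
(*   index 0 = x_0, lift ord0 (lshift n i) = x_{i+1}, lift ord0 (rshift n i) *)
(*   = y_{i+1}   (i : 'I_n).                                                *)
(* Odd variables are indexed by 'I_(m+m) :                                  *)
(*   lshift m r = theta_{r+1}, rshift m r = vartheta_{r+1}   (r : 'I_m).    *)
(* An element of B is  sum_S  p_S * t_S  where S ranges over subsets of the *)
(* odd variables, t_S is the product of the odd variables of S in           *)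
(* increasing index order, and p_S is a polynomial in the even variables.   *)
Definition Bsp (n m : nat) := {ffun {set 'I_(m + m)} -> {mpoly CC[(n + n).+1]}}.

Definition op (n m : nat) := Bsp n m -> Bsp n m.

Definition evx0 (n : nat) : 'I_(n + n).+1 := ord0.
Definition evx (n : nat) (i : 'I_n) : 'I_(n + n).+1 := lift ord0 (lshift n i).
Definition evy (n : nat) (i : 'I_n) : 'I_(n + n).+1 := lift ord0 (rshift n i).
Definition odt (m : nat) (r : 'I_m) : 'I_(m + m) := lshift m r.
Definition odv (m : nat) (r : 'I_m) : 'I_(m + m) := rshift m r.

Definition mulE n m (j : 'I_(n + n).+1) : op n m :=
  fun f => [ffun S => 'X_j * f S].
Definition derE n m (j : 'I_(n + n).+1) : op n m :=
  fun f => [ffun S => mderiv j (f S)].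

Definition osign m (T : {set 'I_(m + m)}) (a : 'I_(m + m)) : CC :=
  (-1) ^+ #|[set b in T | (b < a)%N]|.

(* left multiplication by an odd variable:  a * t_S = +- t_(S + a) or 0 *)
Definition mulO n m (a : 'I_(m + m)) : op n m :=
  fun f => [ffun T : {set 'I_(m + m)} => if a \in T then osign T a *: f (T :\ a) else 0].
(* odd (left) derivation d/da with the super Leibniz rule:
   d_a t_S = +- t_(S - a) if a in S, 0 otherwise *)
Definition derO n m (a : 'I_(m + m)) : op n m :=
  fun f => [ffun T : {set 'I_(m + m)} => if a \in T then 0 else osign T a *: f (a |: T)].

Arguments mulE {n m}.
Arguments derE {n m}.
Arguments mulO {n m}.
Arguments derO {n m}.

Definition opadd n m (F G : op n m) : op n m := fun f => F f + G f.
Definition opsub n m (F G : op n m) : op n m := fun f => F f - G f.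
Definition opneg n m (F : op n m) : op n m := fun f => - F f.

Inductive ospgen (n m : nat) : Type :=
| Gxx of 'I_n & 'I_n   (* E_{i,j} - E_{n+j,n+i} *)
| Gtt of 'I_m & 'I_m   (* E_{2n+r,2n+s} - E_{2n+m+s,2n+m+r} *)
| Gxt of 'I_n & 'I_m   (* E_{i,2n+r} - E_{2n+m+r,n+i} *)
| Gtx of 'I_n & 'I_m   (* E_{2n+r,i} + E_{n+i,2n+m+r} *)
| Gxy of 'I_n & 'I_n   (* i<j : E_{i,n+j} - E_{j,n+i} *)
| Gyx of 'I_n & 'I_n   (* i<j : E_{n+i,j} - E_{n+j,i} *)
| Gvt of 'I_m & 'I_m   (* r<=s : E_{2n+m+r,2n+s} + E_{2n+m+s,2n+r} *)
| Gtv of 'I_m & 'I_m   (* r<=s : E_{2n+r,2n+m+s} + E_{2n+s,2n+m+r} *)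
| Gxv of 'I_n & 'I_m   (* E_{i,2n+m+r} + E_{2n+r,n+i} *)
| Gyt of 'I_n & 'I_m   (* E_{n+i,2n+r} - E_{2n+m+r,i} *)
| G0x of 'I_n          (* E_{0,i} - E_{n+i,0} *)
| G0y of 'I_n          (* E_{0,n+i} - E_{i,0} *)
| G0t of 'I_m          (* E_{0,2n+r} - E_{2n+m+r,0} *)
| G0v of 'I_m.         (* E_{0,2n+m+r} + E_{2n+r,0} *)

Definition ospgen_ok n m (g : ospgen n m) : bool :=
  match g with
  | Gxy i j | Gyx i j => (i < j)%N
  | Gvt r s | Gtv r s => (r <= s)%N
  | _ => true
  end.

(* The images of the spanning set, written as words in the generators
   x_0, d_{x_0}, x_i (xX i), d_{x_i} (xD i), y_i (yX i), d_{y_i} (yD i) and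
   the odd generators; words are composed in the order written. *)
Definition rho_gen n m (xX xD yX yD : 'I_n -> op n m) (g : ospgen n m) : op n m :=
  let X0 := mulE (evx0 n) in
  let D0 := derE (evx0 n) in
  let T r := mulO (odt r) in
  let DT r := derO (odt r) in
  let V r := mulO (odv r) in
  let DV r := derO (odv r) in
  match g with
  | Gxx i j => opsub (xX i \o xD j) (yX j \o yD i)
  | Gtt r s => opsub (T r \o DT s) (V s \o DV r)
  | Gxt i r => opsub (xX i \o DT r) (V r \o yD i)
  | Gtx i r => opadd (T r \o xD i) (yX i \o DV r)
  | Gxy i j => opsub (xX i \o yD j) (xX j \o yD i)
  | Gyx i j => opsub (yX i \o xD j) (yX j \o xD i)
  | Gvt r s => opadd (V r \o DT s) (V s \o DT r)
  | Gtv r s => opadd (T r \o DV s) (T s \o DV r)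
  | Gxv i r => opadd (xX i \o DV r) (T r \o yD i)
  | Gyt i r => opsub (yX i \o DT r) (V r \o xD i)
  | G0x i => opsub (X0 \o xD i) (yX i \o D0)
  | G0y i => opsub (X0 \o yD i) (xX i \o D0)
  | G0t r => opsub (X0 \o DT r) (V r \o D0)
  | G0v r => opadd (X0 \o DV r) (T r \o D0)
  end.

Definition rho n m : ospgen n m -> op n m :=
  rho_gen (fun i => mulE (evx i)) (fun i => derE (evx i))
          (fun i => mulE (evy i)) (fun i => derE (evy i)).

(* sigma(rho(xi)) : sigma(x_r) = d_{x_r}, sigma(d_{x_r}) = -x_r for r <= n1,
   sigma(y_s) = d_{y_s}, sigma(d_{y_s}) = -y_s for s > n2, other generators
   fixed.  (0-based: r+1 <= n1 iff r < n1;  s+1 > n2 iff n2 <= s.) *)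
Definition sigma_rho n m (n1 n2 : nat) : ospgen n m -> op n m :=
  rho_gen
    (fun i => if (i < n1)%N then derE (evx i) else mulE (evx i))
    (fun i => if (i < n1)%N then opneg (mulE (evx i)) else derE (evx i))
    (fun i => if (n2 <= i)%N then derE (evy i) else mulE (evy i))
    (fun i => if (n2 <= i)%N then opneg (mulE (evy i)) else derE (evy i)).

Definition Delta n m (n1 n2 : nat) : op n m := fun f =>
    - (\sum_(i < n | (i < n1)%N) mulE (evx i) (derE (evy i) f))
  + \sum_(r < n | (n1 <= r)%N && (r < n2)%N) derE (evx r) (derE (evy r) f)
  - \sum_(s < n | (n2 <= s)%N) mulE (evy s) (derE (evx s) f)
  + \sum_(r < m) derO (odt r) (derO (odv r) f).

Definition eta n m (n1 n2 : nat) : op n m := fun f =>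
    \sum_(i < n | (i < n1)%N) mulE (evy i) (derE (evx i) f)
  + \sum_(r < n | (n1 <= r)%N && (r < n2)%N) mulE (evx r) (mulE (evy r) f)
  + \sum_(s < n | (n2 <= s)%N) mulE (evx s) (derE (evy s) f)
  + \sum_(r < m) mulO (odt r) (mulO (odv r) f).

Definition Delta' n m (n1 n2 : nat) : op n m := fun f =>
  derE (evx0 n) (derE (evx0 n) f) + Delta n1 n2 f *+ 2.

Definition eta' n m (n1 n2 : nat) : op n m := fun f =>
  mulE (evx0 n) (mulE (evx0 n) f) + eta n1 n2 f *+ 2.

Definition kdeg n m (n1 n2 : nat) (S : {set 'I_(m + m)}) (mm : 'X_{1.. (n + n).+1})
  : int :=
    (mm (evx0 n))%:Z
  + (\sum_(r < n | (n1 <= r)%N) (mm (evx r))%:Z)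
  - (\sum_(i < n | (i < n1)%N) (mm (evx i))%:Z)
  + (\sum_(i < n | (i < n2)%N) (mm (evy i))%:Z)
  - (\sum_(r < n | (n2 <= r)%N) (mm (evy r))%:Z)
  + (#|S|)%:Z.

Definition inBk n m (n1 n2 : nat) (k : int) (f : Bsp n m) : Prop :=
  forall (S : {set 'I_(m + m)}) (mm : 'X_{1.. (n + n).+1}),
    (f S)@_mm != 0 -> kdeg n1 n2 S mm = k.

Definition Hprime n m (n1 n2 : nat) (k : int) (f : Bsp n m) : Prop :=
  inBk n1 n2 k f /\ Delta' n1 n2 f = 0.

Definition etaH n m (n1 n2 : nat) (l : nat) (k : int) (g : Bsp n m) : Prop :=
  exists f, Hprime n1 n2 k f /\ g = iter l (eta' n1 n2) f.

Definition subspace n m (M : Bsp n m -> Prop) : Prop :=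
  [/\ M 0, (forall f g, M f -> M g -> M (f + g))
         & (forall (c : CC) f, M f -> M (c *: f))].

(* submodule of B for the representation xi |-> act xi  (invariance under
   the listed spanning set = invariance under all of osp(2n+1|2m), by
   linearity) *)
Definition submodule n m (act : ospgen n m -> op n m) (M : Bsp n m -> Prop) : Prop :=
  subspace M /\
  (forall g, ospgen_ok g -> forall f, M f -> M (act g f)).

Definition irreducible n m (act : ospgen n m -> op n m) (M : Bsp n m -> Prop) : Prop :=
  [/\ submodule act M,
      (exists f, M f /\ f <> 0)
    & forall N, submodule act N -> (forall f, N f -> M f) ->
        (forall f, N f -> f = 0) \/ (forall f, M f -> N f)].

Definition direct_sum_decomp n m (I : eqType) (V : I -> Bsp n m -> Prop) : Prop :=
  (forall f : Bsp n m, exists (s : seq I) (g : I -> Bsp n m),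
      (forall i, i \in s -> V i (g i)) /\ f = \sum_(i <- s) g i) /\
  (forall (s : seq I) (g : I -> Bsp n m), uniq s ->
      (forall i, i \in s -> V i (g i)) -> \sum_(i <- s) g i = 0 ->
      forall i, i \in s -> g i = 0).

(* Main.v *)
From HB Require Import structures.
Require Import Defs.
From Stdlib Require Import Classical.
From mathcomp Require Import all_boot all_algebra.
From mathcomp Require Import mpoly.
From mathcomp Require Import complex.
From mathcomp Require Import Rstruct.
From mathcomp Require Import ring zify.
Import GRing.Theory.
Local Open Scope ring_scope.

Set Implicit Arguments.
Unset Strict Implicit.
Unset Printing Implicit Defensive.

(* The osp-operators are L_ab = u_a d_b - [ab] u_b d_a, where u_a runs over the
   twisted variables, d_a is the twisted derivative along the variable conjugate
   to a, and [ab] = -1 when a and b are both odd; Delta' = sum_w s_w d_w d_w',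
   eta' = sum_w s_w u_w u_w' and E = sum_w s_w u_w d_w', which is the degree up to
   a shift, span an sl_2 commuting with them.  Let D = 1 + 2n - 2m be the superdimension.
   On harmonic vectors of E-degree e the operator d_a lowers the degree, and
   K_a = (2e - 2 + D) u_a - eta' d_a raises it, both preserving harmonicity.  A
   contraction of two L's shows that K_a d_b and d_b K_a map every submodule N of
   H_e to itself.  Hence, with N_(e-t) = d^t N and N_(e+t) = K^t N, the span of
   all eta'^l N_j is stable under every u_a and d_a.  As B is
   irreducible over the Weyl-Clifford algebra, this span is B as soon as N <> 0.
   The operators E and eta' Delta' have distinct joint eigenvalues on the
   eta'^l H_j because D is odd, so these spaces are independent; comparing the
   components of degree e gives N = H_e, and the choice N_j = H_j gives the
   decomposition of B. *)

(** * Abstract oscillator relations for supercommuting [u], [d] *)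

Section Oscillator.
Variables (F : numFieldType) (B : lmodType F) (I : finType).
Variables (du : I -> I) (p : I -> bool) (s : I -> F).
Variables (u d : I -> {linear B -> B}).

Definition sg a b : F := (-1) ^+ (p a && p b).
(** Value of the supercommutator of [d a] and [u b]. As [d a] differentiates along the conjugate of
    [a], only conjugate indices pair. *)
Definition form a b : F := if b == du a then s b else 0.

Hypothesis duK : involutive du.
Hypothesis p_du : forall a, p (du a) = p a.
Hypothesis s_du : forall a, s (du a) = sg a a * s a.
Hypothesis s_sqr : forall a, s a * s a = 1.
Hypothesis uu : forall a b f, u a (u b f) = sg a b *: u b (u a f).
Hypothesis dd : forall a b f, d a (d b f) = sg a b *: d b (d a f).
Hypothesis du_comm :
  forall a b f, d a (u b f) = sg a b *: u b (d a f) + form a b *: f.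

Lemma sgC a b : sg a b = sg b a.
Proof. by rewrite /sg andbC. Qed.

Lemma sg_sqr a b : sg a b * sg a b = 1.
Proof. by rewrite -expr2 /sg sqrr_sign. Qed.

Lemma sg_dul a b : sg (du a) b = sg a b.
Proof. by rewrite /sg p_du. Qed.

Lemma sg_dur a b : sg a (du b) = sg a b.
Proof. by rewrite /sg p_du. Qed.

Lemma s_s_du a : s a * s (du a) = sg a a.
Proof. by rewrite s_du mulrCA s_sqr mulr1. Qed.

(** Contracting with [form] leaves a single index; the four variants differ in the slot of the
    summed index and in whether it is dualised. *)
Lemma sum_form_l a (k : I -> F) (G : I -> B) :
  \sum_w (k w * form w a) *: G w = (k (du a) * s a) *: G (du a).
Proof.
rewrite (bigD1 (du a)) //= /form duK eqxx big1 ?addr0 // => w wa.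
case: eqP => [aw|_]; last by rewrite mulr0 scale0r.
by rewrite aw duK eqxx in wa.
Qed.

Lemma sum_form_dul a (k : I -> F) (G : I -> B) :
  \sum_w (k w * form (du w) a) *: G w = (k a * s a) *: G a.
Proof.
rewrite (bigD1 a) //= /form duK eqxx big1 ?addr0 // => w wa.
by rewrite duK eq_sym (negPf wa) mulr0 scale0r.
Qed.

Lemma sum_form_r a (k : I -> F) (G : I -> B) :
  \sum_w (k w * form a w) *: G w = (k (du a) * s (du a)) *: G (du a).
Proof.
rewrite (bigD1 (du a)) //= /form eqxx big1 ?addr0 // => w wa.
by rewrite (negPf wa) mulr0 scale0r.
Qed.

Lemma sum_form_dur a (k : I -> F) (G : I -> B) :
  \sum_w (k w * form a (du w)) *: G w = (k a * s (du a)) *: G a.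
Proof.
rewrite (bigD1 a) //= /form eqxx big1 ?addr0 // => w wa.
by rewrite (can_eq duK) (negPf wa) mulr0 scale0r.
Qed.

(** * The sl_2 operators, the osp operators and their commutators *)

Definition Lap f := \sum_w s w *: d w (d (du w) f).
Definition Eta f := \sum_w s w *: u w (u (du w) f).
Definition Eul f := \sum_w s w *: u w (d (du w) f).
Definition Lop a b f := u a (d b f) - sg a b *: u b (d a f).
(** [sg w w] is 1 on even and -1 on odd indices, so this is the superdimension. *)
Definition sdim : F := \sum_w sg w w.

Let lin2 (h h' : I -> {linear B -> B}) :
  linear (fun f => \sum_w s w *: h w (h' (du w) f)).
Proof.
move=> c x y; rewrite scaler_sumr -big_split; apply: eq_bigr => w _ /=.
by rewrite !linearP.
Qed.
HB.instance Definition _ := GRing.isLinear.Build F B B *:%R Lap (lin2 d d).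
HB.instance Definition _ := GRing.isLinear.Build F B B *:%R Eta (lin2 u u).
HB.instance Definition _ := GRing.isLinear.Build F B B *:%R Eul (lin2 u d).

Let Lop_lin a b : linear (Lop a b).
Proof.
move=> c x y; rewrite /Lop !(linearP (d _)) !(linearP (u _)) scalerBr scalerDr !scalerA.
by rewrite (mulrC c) opprD addrACA.
Qed.
HB.instance Definition _ a b :=
  GRing.isLinear.Build F B B *:%R (Lop a b) (Lop_lin a b).

Lemma uD a x y : u a (x + y) = u a x + u a y. Proof. exact: linearD. Qed.
Lemma uB a x y : u a (x - y) = u a x - u a y. Proof. exact: linearB. Qed.
Lemma uZ a c x : u a (c *: x) = c *: u a x. Proof. exact: linearZ. Qed.
Lemma dB a x y : d a (x - y) = d a x - d a y. Proof. exact: linearB. Qed.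
Lemma dZ a c x : d a (c *: x) = c *: d a x. Proof. exact: linearZ. Qed.

Lemma EtaD x y : Eta (x + y) = Eta x + Eta y. Proof. exact: linearD. Qed.
Lemma EtaB x y : Eta (x - y) = Eta x - Eta y. Proof. exact: linearB. Qed.
Lemma EtaZ c x : Eta (c *: x) = c *: Eta x. Proof. exact: linearZ. Qed.

Lemma LopB a b x y : Lop a b (x - y) = Lop a b x - Lop a b y.
Proof. exact: linearB. Qed.

Lemma LopZ a b c x : Lop a b (c *: x) = c *: Lop a b x.
Proof. exact: linearZ. Qed.

Lemma Lap_u a f : Lap (u a f) = u a (Lap f) + d a f *+ 2.
Proof.
rewrite /Lap linear_sum /=.
under eq_bigr => w _.
  rewrite du_comm sg_dul (linearD (d _)) !linearZ /= du_comm !scalerDr !scalerA.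
  rewrite -[s w * _ * sg _ _]mulrA sg_sqr mulr1.
  over.
rewrite !big_split /= -addrA; congr (_ + _).
  by apply: eq_bigr => w _; rewrite linearZ.
(* The contractions of [a] with [w] and with [du w] each contribute one [d a f]. *)
rewrite sum_form_l sum_form_dul s_sqr sg_dul duK scale1r.
by rewrite mulrAC (mulrC (s _)) s_s_du sg_sqr scale1r mulr2n.
Qed.

Lemma d_Eta a f : d a (Eta f) = Eta (d a f) + u a f *+ 2.
Proof.
rewrite /Eta linear_sum /=.
under eq_bigr => w _.
  rewrite linearZ /= du_comm du_comm sg_dur (linearD (u _)) !linearZ /=.
  rewrite !scalerDr !scalerA -[s w * _ * sg _ _]mulrA sg_sqr mulr1.
  over.
rewrite !big_split /= -addrA; congr (_ + _).
rewrite sum_form_r sum_form_dur -mulrA (mulrC (sg _ _)) mulrA s_s_du sg_sqr.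
by rewrite duK s_sqr !scale1r mulr2n.
Qed.

Lemma Eul_u a f : Eul (u a f) = u a (Eul f) + u a f.
Proof.
rewrite /Eul linear_sum /=.
under eq_bigr => w _.
  rewrite du_comm sg_dul (linearD (u _)) !linearZ /= uu.
  rewrite !scalerDr !scalerA -[s w * _ * sg _ _]mulrA sg_sqr mulr1.
  over.
rewrite big_split /= sum_form_dul s_sqr scale1r; congr (_ + _).
by apply: eq_bigr => w _; rewrite linearZ.
Qed.

Lemma d_Eul a f : d a (Eul f) = Eul (d a f) + d a f.
Proof.
rewrite /Eul linear_sum /=.
under eq_bigr => w _.
  rewrite linearZ /= du_comm dd sg_dur !linearZ /=.
  rewrite !scalerDr !scalerA sg_sqr mulr1.
  over.
by rewrite big_split /= sum_form_r duK s_sqr scale1r.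
Qed.

Lemma Lap_d a f : Lap (d a f) = d a (Lap f).
Proof.
rewrite /Lap linear_sum; apply: eq_bigr => w _ /=.
rewrite [RHS]linearZ /= (dd (du w) a) linearZ /= (dd w a) sg_dul.
by rewrite !scalerA -mulrA sg_sqr mulr1.
Qed.

Lemma Eta_u a f : Eta (u a f) = u a (Eta f).
Proof.
rewrite /Eta linear_sum; apply: eq_bigr => w _ /=.
rewrite [RHS]linearZ /= (uu (du w) a) linearZ /= (uu w a) sg_dul.
by rewrite !scalerA -mulrA sg_sqr mulr1.
Qed.

(** Normal ordering: the swap at index [w] leaves the constant [s w * s (du w) = sg w w], and these
    constants add up to the superdimension. *)
Lemma sum_d_u f : \sum_w s w *: d w (u (du w) f) = Eul f + sdim *: f.
Proof.
under eq_bigr => w _.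
  rewrite du_comm scalerDr !scalerA /form eqxx s_s_du sg_dur.
  over.
rewrite big_split /= -scaler_suml; congr (_ + _).
rewrite (reindex_inj (can_inj duK)) /=; apply: eq_bigr => w _.
by rewrite duK s_du sg_dul sg_dur mulrAC sg_sqr mul1r.
Qed.

(** Passing [Lap] through the two factors of [Eta] leaves twice [Eul] from one and twice
    [Eul + sdim], by [sum_d_u], from the other. *)
Lemma Lap_Eta f : Lap (Eta f) = Eta (Lap f) + Eul f *+ 4 + (sdim *+ 2) *: f.
Proof.
rewrite {1}/Eta linear_sum /=.
under eq_bigr => w _.
  rewrite linearZ /= Lap_u Lap_u (linearD (u _)) (raddfMn (u _)) !scalerDr.
  over.
rewrite !big_split /= sum_d_u -!mulr2n mulrnDl -!addrA; congr (_ + _).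
by rewrite -/(Eul f) scalerMnl.
Qed.

(** The corrections [2 d a (d b f)] coming from the two halves of [Lop] cancel by
    supercommutativity. *)
Lemma Lap_Lop a b f : Lap (Lop a b f) = Lop a b (Lap f).
Proof.
rewrite /Lop linearB linearZ /= !Lap_u !Lap_d scalerDr (dd a b).
by rewrite scalerMnr opprD addrACA subrr addr0.
Qed.

Lemma Eta_Lop a b f : Eta (Lop a b f) = Lop a b (Eta f).
Proof.
rewrite /Lop linearB linearZ /= !Eta_u !d_Eta.
rewrite (linearD (u a)) (linearD (u b)) scalerDr (linearMn (u a)) (linearMn (u b)).
by rewrite (uu a b) scalerMnr opprD addrACA subrr addr0.
Qed.

Lemma Lop_swap a b f : Lop b a f = - (sg a b *: Lop a b f).
Proof. by rewrite /Lop scalerBr scalerA sg_sqr scale1r opprB sgC. Qed.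

Lemma iter_Eta_Lop a b l f : iter l Eta (Lop a b f) = Lop a b (iter l Eta f).
Proof. by elim: l => //= l ->; rewrite Eta_Lop. Qed.

Lemma Eul_Lop a b f : Eul (Lop a b f) = Lop a b (Eul f).
Proof.
rewrite /Lop linearB linearZ /= !Eul_u !d_Eul.
by rewrite (linearD (u a)) (linearD (u b)).
Qed.

(** An entry of the square of the matrix of operators L, as in the quadratic Casimir. It is the
    source of [K_d]: the terms [u a (d b f)] and [Eta (d a (d b f))] are those of [Kop] applied to
    [d b f]. *)
Lemma contraction a b f :
  \sum_w s w *: Lop a w (Lop (du w) b f) =
  u a (Eul (d b f)) + (sdim - 2) *: u a (d b f) - Eta (d a (d b f))
  - u a (u b (Lap f)) + sg a b *: u b (Eul (d a f)) + form a b *: Eul f.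
Proof.
(* [Lop (du w) b f] has two terms; [S1] at [h = d b f] sums the first and [S2] the second. Each
   lowers the coefficient [sdim] by one. *)
have S1 h : \sum_w s w *: Lop a w (u (du w) h) =
    u a (Eul h) + (sdim - 1) *: u a h - Eta (d a h).
  under eq_bigr => w _ do rewrite /Lop scalerBr -linearZ.
  rewrite sumrB -linear_sum sum_d_u linearD linearZ /=.
  under [X in _ - X]eq_bigr => w _.
    rewrite du_comm sg_dur (linearD (u _)) !linearZ /= !scalerDr !scalerA.
    rewrite mulrAC sg_sqr mul1r.
    over.
  rewrite big_split /= -/(Eta _) sum_form_dur -mulrA s_s_du sg_sqr scale1r.
  by rewrite scalerBl scale1r opprD (addrC (- Eta _)) !addrA.
have S2 : \sum_w (s w * sg w b) *: Lop a w (u b (d (du w) f)) =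
    u a (u b (Lap f)) + u a (d b f) - sg a b *: u b (Eul (d a f))
    - form a b *: Eul f.
  under eq_bigr => w _ do rewrite /Lop scalerBr -linearZ.
  rewrite sumrB -linear_sum /=.
  under eq_bigr => w _.
    rewrite du_comm scalerDr !scalerA -[s w * _ * sg _ _]mulrA sg_sqr mulr1.
    rewrite -linearZ.
    over.
  rewrite big_split /= -linear_sum sum_form_l duK sg_dul mulrAC.
  rewrite (mulrC (s _)) s_s_du sg_sqr scale1r (linearD (u a)).
  rewrite -[RHS]addrA -opprD; congr (_ - _).
  rewrite /Eul (linear_sum (u b)) !scaler_sumr -big_split; apply: eq_bigr => w _ /=.
  rewrite du_comm (dd a) sg_dur !(linearD (u _)) !linearZ /= (uu w).
  rewrite !scalerDr !scalerA; congr (_ *: _ + _ *: _).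
    transitivity ((sg a w * sg a w) * (sg w b * sg w b) * (sg a b * s w)).
      by ring.
    by rewrite !sg_sqr !mul1r mulrC.
  rewrite /form; case: eqP => [->|]; last by rewrite !mulr0.
  by rewrite sg_dur (sgC w) mulrCA sg_sqr mulr1.
under eq_bigr => w _.
  rewrite [Lop (du w) b f]/Lop sg_dul LopB LopZ scalerBr scalerA.
  over.
rewrite sumrB S1 S2 (_ : sdim - 2 = sdim - 1 - 1); last by ring.
rewrite [in RHS]scalerBl scale1r [in LHS](addrC (u a (u b _))) !opprD !opprK.
by rewrite !addrA (addrAC _ (- Eta _) (- u a _)).
Qed.

(** * Harmonic vectors and the raising operator *)

Definition Kop (e : int) a f :=
  ((2 * e - 2)%:~R + sdim) *: u a f - Eta (d a f).

Let Kop_lin e a : linear (Kop e a).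
Proof.
move=> c x y; rewrite /Kop (linearP (d _)) (linearP (u _)) (linearP Eta) /=.
by rewrite scalerBr scalerDr !scalerA (mulrC c) (opprD (c *: _)) addrACA.
Qed.
HB.instance Definition _ e a :=
  GRing.isLinear.Build F B B *:%R (Kop e a) (Kop_lin e a).

Definition harm (e : int) f := Eul f = e%:~R *: f /\ Lap f = 0.

Lemma harm_d e a f : harm e f -> harm (e - 1) (d a f).
Proof.
move=> [Ef Lf]; split; last by rewrite Lap_d Lf linear0.
by rewrite intrB scalerBl scale1r -linearZ -Ef d_Eul addrK.
Qed.

Lemma harm_Eul_d e a f : harm e f -> Eul (d a f) = (e - 1)%:~R *: d a f.
Proof. by move/(harm_d a) => []. Qed.

Lemma Eul_Eta f : Eul (Eta f) = Eta (Eul f) + Eta f *+ 2.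
Proof.
rewrite {1}/Eta linear_sum /=.
under eq_bigr => w _.
  rewrite linearZ /= Eul_u Eul_u (linearD (u w)) -addrA -mulr2n !scalerDr.
  over.
by rewrite !big_split.
Qed.

(** The coefficient in [Kop] is fixed by this: on harmonic [f], [Lap (u a f)] is [2 d a f], while
    [Lap (Eta (d a f))] is [4 (e - 1) + 2 sdim] times [d a f], because [d a f] is harmonic of degree
    [e - 1]. *)
Lemma harm_K e a f : harm e f -> harm (e + 1) (Kop e a f).
Proof.
move=> hf; have [Ef Lf] := hf; have [Ed Ld] := harm_d a hf.
split.
  rewrite /Kop [Eul _]linearB linearZ /= Eul_u Eul_Eta Ef Ed !linearZ /=.
  have -> : e%:~R *: u a f + u a f = (e + 1)%:~R *: u a f.
    by rewrite intrD scalerDl scale1r.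
  have -> : (e - 1)%:~R *: Eta (d a f) + Eta (d a f) *+ 2 =
            (e + 1)%:~R *: Eta (d a f).
    by rewrite -scaler_nat -scalerDl; congr (_ *: _); rewrite !intrD; ring.
  by rewrite scalerBr !scalerA (mulrC (e + 1)%:~R).
rewrite /Kop [Lap _]linearB linearZ /= Lap_u Lap_Eta Lf Ld Ed !linear0 !add0r.
rewrite -[d a f *+ 2]scaler_nat -[_ *: d a f *+ 4]scaler_nat !scalerA.
rewrite -scalerDl -scalerBl [X in X *: _](_ : _ = 0) ?scale0r //.
by rewrite !intrB intrM; ring.
Qed.

(** For harmonic [f] every [Eul] in [contraction] becomes a scalar and the [Lap] term drops. Thus
    [Kop (e - 1) a (d b f)] stays in any submodule of harmonic vectors containing [f]. *)
Lemma K_d a b e f : harm e f ->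
  Kop (e - 1) a (d b f) =
  \sum_w s w *: Lop a w (Lop (du w) b f) + (e - 1)%:~R *: Lop a b f
  - (form a b * e%:~R) *: f.
Proof.
move=> hf; have [Ef Lf] := hf; rewrite contraction.
rewrite !(harm_Eul_d _ hf) Ef Lf (linear0 (u b)) (linear0 (u a)) subr0.
rewrite [u a (_ *: _)]linearZ [u b (_ *: _)]linearZ scalerA.
rewrite /= !scalerA [RHS]addrAC addrK /Lop /Kop scalerBr !scalerA.
rewrite (mulrC (sg _ _)) addrA [RHS]addrAC addrK addrAC -!scalerDl.
congr (_ *: _ - _).
by rewrite !intrB intrM intrB; ring.
Qed.

(** * Covariance of [u], [d] and [Kop] under [Lop] *)

Lemma form_sym a b : form a b = sg a b * form b a.
Proof.
rewrite /form [b == _]eq_sym (can2_eq duK duK).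
case: eqP => [->|_]; last by rewrite mulr0.
by rewrite sg_dul s_du mulrA sg_sqr mul1r.
Qed.

Lemma form_sg a b c : form a b * sg a c = form a b * sg b c.
Proof.
by rewrite /form; case: eqP => [->|]; [rewrite sg_dul|rewrite !mul0r].
Qed.

(** [Lop a b] acts on the index [c] by the natural representation. The same formula for [d c] and
    [Kop e c] makes the images of a submodule under these families stable again. *)
Lemma Lop_u a b c f :
  Lop a b (u c f) = (sg b c * sg a c) *: u c (Lop a b f)
    + form b c *: u a f - (sg a b * form a c) *: u b f.
Proof.
rewrite /Lop uB !du_comm !uD !uZ (uu c a) (uu c b).
rewrite scalerDr scalerBr !scalerA opprD addrACA !addrA.
congr (_ *: _ - _ *: _ + _ - _).
  by rewrite -mulrA (sgC c) sg_sqr mulr1.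
transitivity (sg a b * sg a c * (sg b c * sg b c)).
  by rewrite sg_sqr mulr1.
by rewrite (sgC c); ring.
Qed.

Lemma Lop_d a b c f :
  Lop a b (d c f) = (sg b c * sg a c) *: d c (Lop a b f)
    + form b c *: d a f - (sg a b * form a c) *: d b f.
Proof.
rewrite /Lop dB dZ !du_comm (dd b c) (dd a c) !uZ.
rewrite !scalerDr !scalerN !scalerDr !scalerA opprD [in RHS]addrACA.
have -> : sg b c * sg a c * form c a = sg a b * form a c.
  rewrite (form_sym c a) (sgC c) mulrA -[sg b c * _ * _]mulrA sg_sqr mulr1.
  by rewrite mulrC (sgC b) -form_sg mulrC.
have -> : sg b c * sg a c * sg a b * form c b = form b c.
  transitivity (sg b c * sg a b * (form c b * sg c a)).
    by rewrite (sgC c a); ring.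
  rewrite form_sg (sgC b a) (form_sym b c).
  transitivity (sg b c * form c b * (sg a b * sg a b)); first by ring.
  by rewrite sg_sqr mulr1.
rewrite [X in X + _ - _]addrA subrK addrK.
congr (_ *: _ - _ *: _).
  by rewrite -mulrA (sgC c) sg_sqr mulr1.
transitivity (sg a b * sg a c * (sg b c * sg b c)).
  by rewrite sg_sqr mulr1.
by rewrite (sgC c); ring.
Qed.

Lemma Lop_K e a b c f :
  Lop a b (Kop e c f) = (sg b c * sg a c) *: Kop e c (Lop a b f)
    + form b c *: Kop e a f - (sg a b * form a c) *: Kop e b f.
Proof.
rewrite /Kop LopB LopZ -Eta_Lop Lop_u Lop_d EtaB EtaD !EtaZ.
have subDB (x1 x2 x3 y1 y2 y3 : B) : x1 + x2 - x3 - (y1 + y2 - y3) =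
    x1 - y1 + (x2 - y2) - (x3 - y3).
  by rewrite !opprD !opprK addrACA (addrACA x1).
rewrite ![in RHS]scalerBr !scalerA scalerBr scalerDr !scalerA.
by rewrite subDB !(mulrC (_ + sdim)).
Qed.

(** * Subspaces and harmonic submodules *)

Definition subsp (N : B -> Prop) :=
  [/\ N 0, forall f g, N f -> N g -> N (f + g) & forall c f, N f -> N (c *: f)].

Lemma subspN N f : subsp N -> N f -> N (- f).
Proof. by case=> _ _ NZ Nf; rewrite -scaleN1r; apply: NZ. Qed.

Lemma subspB N f g : subsp N -> N f -> N g -> N (f - g).
Proof. by move=> sN Nf /(subspN sN); case: sN => _ ND _; apply: ND. Qed.

Lemma subsp_sum N (J : eqType) (r : seq J) (P : pred J) (G : J -> B) :
  subsp N -> (forall j, j \in r -> P j -> N (G j)) -> N (\sum_(j <- r | P j) G j).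
Proof.
by case=> N0 ND _ NG; rewrite big_seq_cond; elim/big_ind: _ => // j /andP[]; apply: NG.
Qed.

Lemma subspK N c f : subsp N -> c != 0 -> N (c *: f) -> N f.
Proof.
by case=> _ _ NZ c0 /(NZ c^-1); rewrite scalerA mulVf // scale1r.
Qed.

(** For a subspace [N], one vector per index is enough to reach every finite sum of vectors
    [T a f]. *)
Definition img (T : I -> B -> B) (N : B -> Prop) g :=
  exists2 h : I -> B, (forall a, N (h a)) & g = \sum_a T a (h a).

Lemma img_mem (T : I -> {linear B -> B}) N a f : subsp N -> N f -> img T N (T a f).
Proof.
case=> N0 _ _ Nf; exists (fun b => if b == a then f else 0).
  by move=> b; case: ifP.
rewrite (bigD1 a) //= eqxx big1 ?addr0 // => b /negPf ->; exact: linear0.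
Qed.

Lemma img_sub (T : I -> B -> B) N M : subsp M ->
  (forall a f, N f -> M (T a f)) -> forall g, img T N g -> M g.
Proof. by move=> sM NM g [h Nh ->]; apply: subsp_sum => // a _ _; apply: NM. Qed.

Lemma img_subsp (T : I -> {linear B -> B}) N : subsp N -> subsp (img T N).
Proof.
move=> sN; have [N0 ND NZ] := sN; split.
- exists (fun=> 0) => //; rewrite big1 // => a _; exact: linear0.
- move=> _ _ [h Nh ->] [k Nk ->]; exists (fun a => h a + k a).
    by move=> a; apply: ND.
  by rewrite -big_split; apply: eq_bigr => a _; rewrite linearD.
- move=> c _ [h Nh ->]; exists (fun a => c *: h a); first by move=> a; apply: NZ.
  by rewrite scaler_sumr; apply: eq_bigr => a _; rewrite linearZ.
Qed.

Definition gsub (e : int) (N : B -> Prop) :=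
  [/\ subsp N, forall f, N f -> harm e f & forall a b f, N f -> N (Lop a b f)].

Lemma harm_subsp e : subsp (harm e).
Proof.
split.
- by split; rewrite ?[Eul _]linear0 ?[Lap _]linear0 ?scaler0.
- move=> f g [Ef Lf] [Eg Lg].
  by split; rewrite ?[Eul _]linearD ?[Lap _]linearD /= ?Ef ?Eg ?Lf ?Lg ?scalerDr ?addr0.
- move=> c f [Ef Lf].
  split; rewrite ?[Eul _]linearZ ?[Lap _]linearZ /= ?Ef ?Lf ?scaler0 //.
  by rewrite !scalerA mulrC.
Qed.

Lemma harm_gsub e : gsub e (harm e).
Proof.
split=> //; first exact: harm_subsp.
move=> a b f [Ef Lf]; split; first by rewrite Eul_Lop Ef LopZ.
by rewrite Lap_Lop Lf [LHS]linear0.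
Qed.

Lemma gsub_img_d e N : gsub e N -> gsub (e - 1) (img d N).
Proof.
move=> [sN Nh NL]; have sd := img_subsp d sN; split=> //.
  by apply: img_sub (harm_subsp _) _ => a f /Nh; apply: harm_d.
move=> a b _ [h Nh' ->]; rewrite linear_sum; apply: subsp_sum => // c _ _ /=.
rewrite Lop_d; have [_ dD dZ'] := sd.
by apply: subspB => //; [apply: dD|]; apply: dZ'; apply: img_mem => //; apply: NL.
Qed.

Lemma gsub_img_K e N : gsub e N -> gsub (e + 1) (img (Kop e) N).
Proof.
move=> [sN Nh NL]; have sd := img_subsp (Kop e) sN; split=> //.
  by apply: img_sub (harm_subsp _) _ => a f /Nh; apply: harm_K.
move=> a b _ [h Nh' ->]; rewrite linear_sum; apply: subsp_sum => // c _ _ /=.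
rewrite Lop_K; have [_ dD dZ'] := sd.
have mem c' f : N f -> img (Kop e) N (Kop e c' f).
  exact: (img_mem (Kop e)).
by apply: subspB => //; [apply: dD|]; apply: dZ'; apply: mem => //; apply: NL.
Qed.

Lemma gsub_K_d e N a b f : gsub e N -> N f -> N (Kop (e - 1) a (d b f)).
Proof.
move=> [sN Nh NL] Nf; have [_ ND NZ] := sN.
rewrite (K_d _ _ (Nh _ Nf)); apply: subspB => //; last exact: NZ.
apply: ND; last by apply/NZ/NL.
by apply: subsp_sum => // w _ _; apply/NZ/NL/NL.
Qed.

(** Reversing the order reduces this to [gsub_K_d]: lowering the degree in [Kop] changes its
    coefficient by 2, and the difference joins the commutator of [d b] with [Eta] into
    [2 *: Lop a b f], leaving a multiple of [f]. *)
Lemma gsub_d_K e N a b f : gsub e N -> N f -> N (d b (Kop e a f)).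
Proof.
move=> gN Nf; have [sN Nh NL] := gN; have [_ ND NZ] := sN.
have -> : d b (Kop e a f) = sg a b *: (Kop (e - 1) a (d b f) + 2 *: Lop a b f)
    + (((2 * e - 2)%:~R + sdim) * form b a) *: f.
  rewrite /Kop dB dZ d_Eta du_comm (dd a b) EtaZ (sgC b a).
  have -> : (2 * (e - 1) - 2)%:~R + sdim = (2 * e - 2)%:~R + sdim - 2 :> F.
    by rewrite !intrB !intrM !intrB; ring.
  move: ((2 * e - 2)%:~R + sdim) => k.
  rewrite 2!(scalerDr (sg a b)) (scalerDr k).
  have -> : sg a b *: (2 *: Lop a b f) =
      (sg a b * 2) *: u a (d b f) - u b (d a f) *+ 2.
    rewrite /Lop !scalerBr !scalerA mulrAC sg_sqr mul1r scaler_nat.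
    by rewrite mulrC.
  have -> : sg a b *: ((k - 2) *: u a (d b f)) =
      (k * sg a b) *: u a (d b f) - (sg a b * 2) *: u a (d b f).
    by rewrite scalerA mulrBr scalerBl (mulrC k).
  rewrite scalerN !scalerA sg_sqr scale1r.
  rewrite opprD (addrAC (_ *: _) (- _) (- Eta _)) !addrA subrK.
  by rewrite [RHS]addrAC [X in X - _ = _]addrAC.
by apply/ND/NZ => //; apply/NZ/ND; [exact: gsub_K_d|exact/NZ/NL].
Qed.

Lemma gsub_K_d_sub e N g : gsub e N -> img (Kop (e - 1)) (img d N) g -> N g.
Proof.
move=> gN; have [sN _ _] := gN; apply: img_sub => // a.
move=> _ [h Nh ->]; rewrite linear_sum; apply: subsp_sum => // b _ _.
exact: gsub_K_d.
Qed.

Lemma gsub_d_K_sub e N g : gsub e N -> img d (img (Kop e) N) g -> N g.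
Proof.
move=> gN; have [sN _ _] := gN; apply: img_sub => // a.
move=> _ [h Nh ->]; rewrite linear_sum; apply: subsp_sum => // b _ _.
exact: gsub_d_K.
Qed.

(** * The graded tower generated by a submodule *)

Definition lowering N t := iter t (img d) N.
Fixpoint raising e N t : B -> Prop :=
  if t is t'.+1 then img (Kop (e + t'%:Z)) (raising e N t') else N.

Lemma gsub_lowering e N t : gsub e N -> gsub (e - t%:Z) (lowering N t).
Proof.
move=> gN; elim: t => [|t IH]; first by rewrite subr0.
by rewrite intS opprD addrCA addrC; apply: gsub_img_d.
Qed.

Lemma gsub_raising e N t : gsub e N -> gsub (e + t%:Z) (raising e N t).
Proof.
move=> gN; elim: t => [|t IH]; first by rewrite addr0.
by rewrite intS addrCA addrC; apply: gsub_img_K.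
Qed.

(** The family N_j of the overview, with one branch on each side of [e]. The branches overlap only
    at [j = e], where both give [N]. *)
Definition tower e N (j : int) f :=
  (exists2 t, j = e - t%:Z & lowering N t f) \/
  (exists2 t, j = e + t%:Z & raising e N t f).

Lemma tower_harm e N j f : gsub e N -> tower e N j f -> harm j f.
Proof.
move=> gN [] [t ->].
  by have [_ H _] := gsub_lowering t gN; apply: H.
by have [_ H _] := gsub_raising t gN; apply: H.
Qed.

Lemma tower_base e N f : tower e N e f <-> N f.
Proof.
split=> [|Nf]; last by left; exists 0%N; rewrite ?subr0.
by case=> [] [[|t]] //=; lia.
Qed.

(** At or below [e] this is one more lowering step; above [e] the derivative undoes a raising step,
    by [gsub_d_K_sub]. [tower_K] is the mirror image. *)
Lemma tower_d e N j a f : gsub e N -> tower e N j f -> tower e N (j - 1) (d a f).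
Proof.
move=> gN; have lowering_case t g : lowering N t g -> tower e N (e - t%:Z - 1) (d a g).
  move=> Ng; left; exists t.+1; first by lia.
  by apply: img_mem => //; case: (gsub_lowering t gN).
case=> [] [[|t] -> Ng]; try exact: lowering_case.
  by rewrite (_ : e + 0%:Z = e - 0%:Z); [exact: lowering_case | lia].
right; exists t; first by lia.
apply: (gsub_d_K_sub (gsub_raising t gN)); apply: img_mem => //.
by case: (gsub_raising t.+1 gN).
Qed.

Lemma tower_K e N j a f : gsub e N -> tower e N j f -> tower e N (j + 1) (Kop j a f).
Proof.
move=> gN; have raising_case t g : raising e N t g ->
    tower e N (e + t%:Z + 1) (Kop (e + t%:Z) a g).
  move=> Ng; right; exists t.+1; first by lia.
  by apply: (img_mem (Kop (e + t%:Z))) => //; case: (gsub_raising t gN).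
case=> [] [[|t] -> Ng]; try exact: raising_case.
left; exists t; first by lia.
apply: (gsub_K_d_sub (gsub_lowering t gN)).
rewrite (_ : e - t.+1%:Z = e - t%:Z - 1); last by lia.
by apply: (img_mem (Kop _)) => //; case: (gsub_lowering t.+1 gN).
Qed.

(** * Eigenvalues on [Eta]-powers of harmonics, and independence *)

Lemma Eul_iter_Eta e l f : harm e f ->
  Eul (iter l Eta f) = (e + 2 * l%:Z)%:~R *: iter l Eta f.
Proof.
move=> [Ef _]; elim: l => [|l IH]; first by rewrite mulr0 addr0.
rewrite iterS Eul_Eta IH EtaZ -scaler_nat -scalerDl; congr (_ *: _).
by rewrite intS !intrD !intrM intrD; ring.
Qed.

(** The usual sl_2 string computation, by induction with [Lap_Eta]. At [l = 0] the truncated [l.-1]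
    is harmless, since the coefficient vanishes. *)
Lemma Lap_iter_Eta e l f : harm e f ->
  Lap (iter l Eta f) =
  (2 * l%:R * ((2 * (e + l%:Z - 1))%:~R + sdim)) *: iter l.-1 Eta f.
Proof.
move=> hf; elim: l => [|l IH]; first by rewrite mulr0 mul0r scale0r; case: hf.
rewrite iterS Lap_Eta IH EtaZ (Eul_iter_Eta _ hf) /=.
have -> : (2 * l%:R * ((2 * (e + l%:Z - 1))%:~R + sdim)) *: Eta (iter l.-1 Eta f) =
    (2 * l%:R * ((2 * (e + l%:Z - 1))%:~R + sdim)) *: iter l Eta f.
  by case: l {IH} => [|l] //; rewrite !(mulr0, mul0r) !scale0r.
rewrite -[_ *: _ *+ 4]scaler_nat scalerA -!scalerDl; congr (_ *: _).
by rewrite !(intrD, intrM, intrB) intS !intrD; ring.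
Qed.

Variable q : int.
Hypothesis sdim_odd : sdim = (2 * q + 1)%:~R.

(** The sum is an odd integer. Injectivity of [Eta] powers and the division in [spanV_all] both rest
    on it. *)
Lemma odd_scalar_neq0 (e : int) : (2 * e)%:~R + sdim != 0.
Proof. by rewrite sdim_odd -intrD intr_eq0; lia. Qed.

Lemma iter_Eta_eq0 e l f : harm e f -> iter l Eta f = 0 -> f = 0.
Proof.
move=> hf; elim: l => // l IH /(congr1 Lap).
rewrite (Lap_iter_Eta _ hf) [Lap 0]linear0 => /eqP.
rewrite scaler_eq0 !mulf_eq0 (negPf (odd_scalar_neq0 _)) !Num.Theory.pnatr_eq0.
by move/eqP.
Qed.

Definition etaV (N : int -> B -> Prop) (i : nat * int) g :=
  exists2 f, N i.2 f & g = iter i.1 Eta f.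

(** [Eul] separates different total degrees [e + 2l]; within one total degree [Eta \o Lap] does. *)
Lemma separate (i j : nat * int) : i != j ->
  exists (A : {linear B -> B}) (mu : nat * int -> F),
    (forall k x, etaV harm k x -> A x = mu k *: x) /\ mu i != mu j.
Proof.
move: i j => [l e] [l' e'] ij.
have [eq_deg|ne_deg] := eqVneq (e + 2 * l%:Z) (e' + 2 * l'%:Z); last first.
  exists Eul, (fun k => (k.2 + 2 * k.1%:Z)%:~R); split.
    by move=> k _ [f hf ->]; apply: Eul_iter_Eta.
  by rewrite eqr_int.
exists (Eta \o Lap),
  (fun k => (2 * k.1%:Z * (2 * (k.2 + k.1%:Z - 1) + (2 * q + 1)))%:~R); split.
  move=> k _ [f hf ->] /=; rewrite (Lap_iter_Eta _ hf) EtaZ sdim_odd -intrD !intrM.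
  by case: k.1 => [|l0]; rewrite ?mulr0 ?mul0r ?scale0r.
rewrite eqr_int /=; apply: contra_neq ij => H.
(* Half the difference of the two eigenvalues at equal total degree. The second factor is odd, hence
   nonzero, so [l = l']. *)
have /eqP : (l%:Z - l'%:Z) * (2 * (e + 2 * l%:Z) - 2 * (l%:Z + l'%:Z) + 2 * q - 1) = 0.
  have := eq_deg; nia.
by rewrite mulf_eq0 => /orP[] /eqP ?; [congr (_, _); lia | lia].
Qed.

Lemma etaV_scale N (sN : forall e, subsp (N e)) i c x :
  etaV N i x -> etaV N i (c *: x).
Proof.
case=> f Nf ->; exists (c *: f); first by case: (sN i.2) => _ _; apply.
by elim: i.1 => //= l <-; rewrite EtaZ.
Qed.

(** Elimination of eigenvectors one at a time. The labels of the [g t] may repeat, as they do in a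
    spanning sequence; they only have to avoid [i]. *)
Lemma etaV_indep (T : eqType) (r : seq T) (ix : T -> nat * int) (g : T -> B) i g0 :
  etaV harm i g0 -> (forall t, t \in r -> etaV harm (ix t) (g t) /\ ix t != i) ->
  g0 + \sum_(t <- r) g t = 0 -> g0 = 0.
Proof.
elim: r g g0 => [|t r IH] g g0 Vg0 Vg; first by rewrite big_nil addr0.
have [Vt ti] := Vg t (mem_head _ _).
have [A [mu [Amu mu_ij]]] := separate ti.
rewrite big_cons => sum0.
have mu0 : mu i - mu (ix t) != 0 by rewrite subr_eq0 eq_sym.
suff /eqP : (mu i - mu (ix t)) *: g0 = 0.
  by rewrite scaler_eq0 (negPf mu0) => /eqP.
(* Applying [A - mu (ix t)] to the relation kills [g t] and rescales the other terms, [g0] by a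
   nonzero factor. *)
apply: (IH (fun t' => (mu (ix t') - mu (ix t)) *: g t')).
- exact: etaV_scale harm_subsp _ _ _ Vg0.
- move=> t' rt'; have [|V' ?] := Vg t'; first by rewrite inE rt' orbT.
  by split=> //; apply: etaV_scale harm_subsp _ _ _ V'.
transitivity (A (g0 + (g t + \sum_(t' <- r) g t')) -
    mu (ix t) *: (g0 + (g t + \sum_(t' <- r) g t'))); last first.
  by rewrite sum0 linear0 scaler0 subrr.
rewrite !(linearD A) (Amu _ _ Vg0) (Amu _ _ Vt) linear_sum !scalerDr scaler_sumr.
have sub3 (x x' y z z' : B) : x + (y + z) - (x' + (y + z')) = x - x' + (z - z').
  by rewrite opprD addrACA opprD (addrACA y) subrr add0r.
rewrite sub3 -scalerBl -sumrB.
congr (_ + _); apply: eq_big_seq => t' rt' /=.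
have [|V' _] := Vg t'; first by rewrite inE rt' orbT.
by rewrite (Amu _ _ V') scalerBl.
Qed.

(** * Spanning the whole space from a graded family *)

Definition spanV (N : int -> B -> Prop) f :=
  exists2 r : seq ((nat * int) * B),
    (forall t, t \in r -> etaV N t.1 t.2) & f = \sum_(t <- r) t.2.

Lemma spanV_mem N i f : etaV N i f -> spanV N f.
Proof.
move=> Vf; exists [:: (i, f)]; last by rewrite big_seq1.
by move=> t; rewrite inE => /eqP ->.
Qed.

Lemma spanV_subsp N : (forall i c f, etaV N i f -> etaV N i (c *: f)) ->
  subsp (spanV N).
Proof.
move=> NZ; split.
- by exists [::]; rewrite ?big_nil.
- move=> _ _ [r Vr ->] [r' Vr' ->]; exists (r ++ r'); last by rewrite big_cat.
  by move=> t; rewrite mem_cat => /orP[rt|rt]; [exact: Vr | exact: Vr'].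
- move=> c _ [r Vr ->]; exists [seq (t.1, c *: t.2) | t <- r].
    by move=> _ /mapP[t rt ->] /=; apply: NZ; apply: Vr.
  by rewrite scaler_sumr big_map.
Qed.

Lemma spanV_stable N (A : {linear B -> B}) :
  (forall i c f, etaV N i f -> etaV N i (c *: f)) ->
  (forall i f, etaV N i f -> spanV N (A f)) -> forall f, spanV N f -> spanV N (A f).
Proof.
move=> NZ NA _ [r Vr ->]; rewrite linear_sum.
by apply: subsp_sum (spanV_subsp NZ) _ => t rt _; apply: NA (Vr _ rt).
Qed.

(** Supplied by [up_dn_irr] for the concrete superalgebra. *)
Hypothesis weyl_irr : forall M : B -> Prop, subsp M ->
  (forall a f, M f -> M (u a f)) -> (forall a f, M f -> M (d a f)) ->
  (exists2 f, M f & f != 0) -> forall f, M f.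

Lemma iter_Eta_u l a f : iter l Eta (u a f) = u a (iter l Eta f).
Proof. by elim: l => //= l ->; rewrite Eta_u. Qed.

Lemma d_iter_Eta l a f :
  d a (iter l Eta f) = iter l Eta (d a f) + (2 * l%:R) *: u a (iter l.-1 Eta f).
Proof.
elim: l => [|l IH]; first by rewrite mulr0 scale0r addr0.
rewrite iterS d_Eta IH EtaD EtaZ Eta_u -addrA; congr (_ + _).
have -> : (2 * l%:R) *: u a (Eta (iter l.-1 Eta f)) =
    (2 * l%:R) *: u a (iter l Eta f).
  by case: l {IH} => [|l] //; rewrite mulr0 !scale0r.
by rewrite -scaler_nat -scalerDl /= -[in RHS]natr1; congr (_ *: _); ring.
Qed.

Lemma iter_EtaP l c f g : iter l Eta (c *: f + g) = c *: iter l Eta f + iter l Eta g.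
Proof. by elim: l => //= l ->; rewrite EtaD EtaZ. Qed.

Lemma iter_EtaZ l c f : iter l Eta (c *: f) = c *: iter l Eta f.
Proof. by elim: l => //= l ->; rewrite EtaZ. Qed.

(* [u a f = kappa^-1 (Kop e a f + Eta (d a f))] for [f] harmonic of degree [e]. *)
Lemma spanV_all (N : int -> B -> Prop) :
  (forall e f, N e f -> harm e f) ->
  (forall e c f, N e f -> N e (c *: f)) ->
  (forall e a f, N e f -> N (e - 1) (d a f)) ->
  (forall e a f, N e f -> N (e + 1) (Kop e a f)) ->
  (exists e, exists2 f, N e f & f != 0) -> forall f, spanV N f.
Proof.
move=> Nh NZ Nd NK [e [f Nf f0]].
have VZ i c g : etaV N i g -> etaV N i (c *: g).
  by case=> h Nh' ->; exists (c *: h); [apply: NZ | rewrite iter_EtaZ].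
have [S0 SD SZ] := spanV_subsp VZ.
have Su l e' a g : N e' g -> spanV N (u a (iter l Eta g)).
  move=> Ng; have k0 := odd_scalar_neq0 (e' - 1).
  have k0' : (2 * e' - 2)%:~R + sdim != 0 by move: k0; rewrite mulrBr mulr1.
  apply: (subspK (And3 S0 SD SZ) k0'); rewrite -iter_Eta_u -iter_EtaZ.
  have -> : ((2 * e' - 2)%:~R + sdim) *: u a g = 1 *: Kop e' a g + Eta (d a g).
    by rewrite scale1r /Kop subrK.
  rewrite iter_EtaP scale1r; apply: SD.
    by apply: (@spanV_mem _ (l, e' + 1)); exists (Kop e' a g) => //; apply: NK.
  by apply: (@spanV_mem _ (l.+1, e' - 1)); exists (d a g); [apply: Nd | rewrite iterSr].
apply: weyl_irr.
- by split.
- move=> a; apply: spanV_stable => // -[l e'] _ [g Ng ->]; exact: (Su l e' a g Ng).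
- move=> a; apply: spanV_stable => // -[l e'] _ [g Ng ->] /=; rewrite d_iter_Eta.
  apply: SD; last by apply/SZ/Su/Ng.
  by apply: (@spanV_mem _ (l, e' - 1)); exists (d a g) => //; apply: Nd.
- by exists f => //; apply: (@spanV_mem _ (0%N, e)); exists f.
Qed.

Lemma harm_spanV e f0 : harm e f0 -> f0 != 0 -> forall f, spanV harm f.
Proof.
move=> hf0 f0n; apply: spanV_all => //.
- by move=> e' c f; case: (harm_subsp e') => _ _; apply.
- by move=> *; apply: harm_d.
- by move=> *; apply: harm_K.
- by exists e, f0.
Qed.

(** * Irreducibility of the harmonic spaces and their [Eta]-images *)

Lemma gsub_harm_irr e N : gsub e N ->
  (forall f, N f -> f = 0) \/ (forall f, harm e f -> N f).
Proof.
move=> gN; have [sN Nh _] := gN; have [N0 _ NZ] := sN.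
have [[f0 Nf0 f0n]|none] := classic (exists2 f, N f & f != 0); last first.
  left=> f Nf; apply/eqP/negPn/negP => fn; apply: none; by exists f.
right=> f hf; have [|||||r Vr fr] := @spanV_all (tower e N) _ _ _ _ _ f.
- by move=> *; apply: tower_harm gN _.
- move=> j c g [] [t -> Ng]; [left|right]; exists t => //.
    by case: (gsub_lowering t gN) => [[_ _ H] _ _]; apply: H.
  by case: (gsub_raising t gN) => [[_ _ H] _ _]; apply: H.
- by move=> *; apply: tower_d.
- by move=> *; apply: tower_K.
- by exists e, f0 => //; apply/tower_base.
(* The part of the expansion labelled [(0, e)] lies in [N] by [tower_base]; independence shows that
   it is all of [f]. *)
pose P := [pred t : (nat * int) * B | t.1 == (0%N, e)].
have Nsum : N (\sum_(t <- r | P t) t.2).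
  apply: subsp_sum => // -[i g] rt /= /eqP ei; have [h] := Vr _ rt.
  by rewrite ei /= => /(tower_base e) Nh' ->.
suff /subr0_eq -> : f - \sum_(t <- r | P t) t.2 = 0 by [].
apply: (@etaV_indep _ [seq t <- r | ~~ P t] fst (fun t => - t.2) (0%N, e)).
- exists (f - \sum_(t <- r | P t) t.2) => //=.
  by apply: subspB (harm_subsp e) _ _ => //; apply: Nh.
- move=> t; rewrite mem_filter => /andP[nPt rt]; split=> //.
  rewrite -scaleN1r; apply: (etaV_scale harm_subsp); have [h Nh' ->] := Vr _ rt.
  by exists h => //; apply: tower_harm gN _.
by rewrite big_filter sumrN fr (bigID P) /= addrAC addrK subrr.
Qed.

Lemma iter_EtaD l f g : iter l Eta (f + g) = iter l Eta f + iter l Eta g.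
Proof. by rewrite -[f]scale1r iter_EtaP !scale1r. Qed.

Lemma iter_Eta0 l : iter l Eta 0 = 0.
Proof. by elim: l => //= l ->; exact: linear0. Qed.

Lemma etaV_subsp N i : subsp (N i.2) -> subsp (etaV N i).
Proof.
case=> N0 ND NZ; split.
- by exists 0 => //; rewrite iter_Eta0.
- move=> _ _ [f Nf ->] [g Ng ->]; exists (f + g); first exact: ND.
  by rewrite iter_EtaD.
- move=> c _ [f Nf ->]; exists (c *: f); first exact: NZ.
  by rewrite iter_EtaZ.
Qed.

Lemma etaV_Lop i a b f : etaV harm i f -> etaV harm i (Lop a b f).
Proof.
case=> h hh ->; exists (Lop a b h); last by rewrite iter_Eta_Lop.
by have [_ _ H] := harm_gsub i.2; apply: H.
Qed.

(** [Eta] commutes with every [Lop], so the preimage [N'] of [N] under the power of [Eta] is a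
    submodule of the harmonic space, to which [gsub_harm_irr] applies. *)
Lemma etaV_harm_irr i N : subsp N -> (forall a b f, N f -> N (Lop a b f)) ->
  (forall f, N f -> etaV harm i f) ->
  (forall f, N f -> f = 0) \/ (forall f, etaV harm i f -> N f).
Proof.
move=> [N0 ND NZ] NL NV.
have [[H0 HD HZ] _ HL] := harm_gsub i.2.
pose N' f := harm i.2 f /\ N (iter i.1 Eta f).
have gN : gsub i.2 N'.
  split=> [|f []//|a b f [hf Nf]]; last first.
    by split; [exact: HL|rewrite iter_Eta_Lop; exact: NL].
  split; first by split; rewrite ?iter_Eta0.
    move=> f g [hf Nf] [hg Ng].
    by split; [exact: HD|rewrite iter_EtaD; exact: ND].
  by move=> c f [hf Nf]; split; [exact: HZ|rewrite iter_EtaZ; exact: NZ].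
have [z|all] := gsub_harm_irr gN; [left|right].
  move=> g Ng; have [f hf gE] := NV g Ng.
  by rewrite gE (z f) ?iter_Eta0 //; split; rewrite // -gE.
by move=> g [f /all[_ Nf] ->].
Qed.

End Oscillator.

(** * Weyl and Clifford relations of the basic operators *)

Section BasicOperators.
Variables n m : nat.
Implicit Types (f g : Bsp n m) (i j : 'I_(n + n).+1) (a b : 'I_(m + m)).

Lemma mulE_linear i : linear (@mulE n m i).
Proof. by move=> c f g; apply/ffunP=> S; rewrite !ffunE mulrDr -scalerAr. Qed.
HB.instance Definition _ i :=
  GRing.isLinear.Build CC (Bsp n m) (Bsp n m) *:%R (mulE i) (mulE_linear i).

Lemma derE_linear i : linear (@derE n m i).
Proof. by move=> c f g; apply/ffunP=> S; rewrite !ffunE linearP. Qed.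
HB.instance Definition _ i :=
  GRing.isLinear.Build CC (Bsp n m) (Bsp n m) *:%R (derE i) (derE_linear i).

Lemma mulO_linear a : linear (@mulO n m a).
Proof.
move=> c f g; apply/ffunP=> S; rewrite !ffunE.
by case: ifP; rewrite ?scaler0 ?addr0 // scalerDr !scalerA mulrC.
Qed.
HB.instance Definition _ a :=
  GRing.isLinear.Build CC (Bsp n m) (Bsp n m) *:%R (mulO a) (mulO_linear a).

Lemma derO_linear a : linear (@derO n m a).
Proof.
move=> c f g; apply/ffunP=> S; rewrite !ffunE.
by case: ifP; rewrite ?scaler0 ?addr0 // scalerDr !scalerA mulrC.
Qed.
HB.instance Definition _ a :=
  GRing.isLinear.Build CC (Bsp n m) (Bsp n m) *:%R (derO a) (derO_linear a).

Lemma opneg_linear (F : {linear Bsp n m -> Bsp n m}) : linear (opneg F).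
Proof. by move=> c f g; rewrite /opneg linearP opprD scalerN. Qed.
HB.instance Definition _ (F : {linear Bsp n m -> Bsp n m}) :=
  GRing.isLinear.Build CC (Bsp n m) (Bsp n m) *:%R (opneg F) (opneg_linear F).

Lemma mulE_mulE i j f : mulE i (mulE j f) = mulE j (mulE i f).
Proof. by apply/ffunP=> S; rewrite !ffunE mulrCA. Qed.

Lemma derE_derE i j f : derE i (derE j f) = derE j (derE i f).
Proof. by apply/ffunP=> S; rewrite !ffunE mderiv_comm. Qed.

Lemma derE_mulE i j f :
  derE i (mulE j f) = mulE j (derE i f) + (if i == j then f else 0).
Proof.
apply/ffunP=> S; rewrite !ffunE mderivM mderivX mnm1E addrC eq_sym; congr (_ + _).
case: eqP => [->|_]; last by rewrite scale0r mul0r !ffunE.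
rewrite scale1r (_ : (U_(j) - U_(j))%MM = 0%MM) ?mpolyX0 ?mul1r //.
by apply/mnmP => k; rewrite mnmBE subnn mnm0E.
Qed.

Lemma mulO_mulE a i f : mulO a (mulE i f) = mulE i (mulO a f).
Proof.
by apply/ffunP=> S; rewrite !ffunE; case: ifP; rewrite ?mulr0 // scalerAr.
Qed.

Lemma mulO_derE a i f : mulO a (derE i f) = derE i (mulO a f).
Proof.
by apply/ffunP=> S; rewrite !ffunE; case: ifP; rewrite ?linear0 // linearZ.
Qed.

Lemma derO_mulE a i f : derO a (mulE i f) = mulE i (derO a f).
Proof.
by apply/ffunP=> S; rewrite !ffunE; case: ifP; rewrite ?mulr0 // scalerAr.
Qed.

Lemma derO_derE a i f : derO a (derE i f) = derE i (derO a f).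
Proof.
by apply/ffunP=> S; rewrite !ffunE; case: ifP; rewrite ?linear0 // linearZ.
Qed.

Lemma osign_sqr (S : {set 'I_(m + m)}) a : osign S a * osign S a = 1.
Proof. by rewrite -expr2 /osign sqrr_sign. Qed.

(** [osign] counts the variables before [b], so inserting [a] matters exactly when [a] precedes
    [b]. *)
Lemma osignU1 (S : {set 'I_(m + m)}) a b :
  a \notin S -> osign (a |: S) b = (-1) ^+ (a < b)%N * osign S b.
Proof.
move=> aS; rewrite /osign -exprD; congr (_ ^+ _).
case: ltnP => ab.
  rewrite (_ : [set _ in _ | _] = a |: [set c in S | (c < b)%N]).
    by rewrite cardsU1 inE (negPf aS).
  by apply/setP => c; rewrite !inE; case: eqP => [->|] //=; rewrite ab.
congr #|pred_of_set _|; apply/setP => c; rewrite !inE.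
by case: eqP => [->|] //=; rewrite ltnNge ab (negPf aS).
Qed.

Lemma osignD1 (S : {set 'I_(m + m)}) a b :
  a \in S -> osign (S :\ a) b = (-1) ^+ (a < b)%N * osign S b.
Proof.
move=> aS; rewrite -[in RHS](setD1K aS) osignU1 ?setD11 //.
by rewrite mulrA -expr2 sqrr_sign mul1r.
Qed.

(** Exactly one of two distinct odd variables precedes the other: the source of every
    anticommutation sign below. *)
Lemma sign_lt_neq a b : a != b -> (-1) ^+ (a < b)%N = - (-1) ^+ (b < a)%N :> CC.
Proof.
by rewrite -val_eqE neq_ltn => /orP[] H; rewrite H ltnNge (ltnW H) /= ?opprK.
Qed.

Lemma mulO_mulO a b f : mulO a (mulO b f) = - mulO b (mulO a f).
Proof.
apply/ffunP=> S; rewrite !ffunE !in_setD1.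
have [<-|ab] := eqVneq a b.
  by rewrite ?eqxx /=; case: ifP; rewrite ?scaler0 oppr0.
case aS: (a \in S); case bS: (b \in S); rewrite /= ?scaler0 ?oppr0 //.
rewrite (osignD1 _ aS) (osignD1 _ bS) !scalerA (sign_lt_neq ab).
rewrite setDDl setUC -setDDl mulNr mulrN scaleNr; congr (- (_ *: _)); ring.
Qed.

Lemma derO_derO a b f : derO a (derO b f) = - derO b (derO a f).
Proof.
apply/ffunP=> S; rewrite !ffunE !in_setU1.
have [<-|ab] := eqVneq a b.
  by rewrite ?eqxx /=; case: ifP; rewrite ?scaler0 oppr0.
case aS: (a \in S); case bS: (b \in S); rewrite /= ?scaler0 ?oppr0 //.
rewrite (osignU1 _ (negbT aS)) (osignU1 _ (negbT bS)) !scalerA (sign_lt_neq ab).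
rewrite setUCA mulNr mulrN scaleNr; congr (- (_ *: _)); ring.
Qed.

Lemma derO_mulO a b f :
  derO a (mulO b f) = - mulO b (derO a f) + (if a == b then f else 0).
Proof.
apply/ffunP=> S; rewrite !ffunE !(in_setU1, in_setD1).
have [<-|ab] := eqVneq a b.
  rewrite ?eqxx /=; case aS: (a \in S).
    by rewrite osignD1 // ltnn mul1r scalerA osign_sqr scale1r setD1K // addNr.
  rewrite osignU1 ?aS // ltnn mul1r scalerA osign_sqr scale1r setU1K ?aS //.
  by rewrite oppr0 add0r.
rewrite ffunE addr0.
case aS: (a \in S); case bS: (b \in S); rewrite /= ?scaler0 ?oppr0 //.
rewrite osignD1 ?osignU1 ?aS // !scalerA (sign_lt_neq ab).
have -> : (a |: S) :\ b = a |: S :\ b.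
  by apply/setP => c; rewrite !inE; have [->|] := eqVneq c a; rewrite ?ab.
by rewrite mulNr mulrN scaleNr; congr (- (_ *: _)); ring.
Qed.

(** * Irreducibility under multiplications and derivations *)

Definition mono (S : {set 'I_(m + m)}) (p : {mpoly CC[(n + n).+1]}) : Bsp n m :=
  [ffun T => if T == S then p else 0].

Lemma weyl_clifford_irr (M : Bsp n m -> Prop) : subsp M ->
  (forall i f, M f -> M (mulE i f)) -> (forall i f, M f -> M (derE i f)) ->
  (forall a f, M f -> M (mulO a f)) -> (forall a f, M f -> M (derO a f)) ->
  (exists2 f, M f & f != 0) -> forall f, M f.
Proof.
move=> sM MmE MdE MmO MdO [f0 Mf0 f0n]; have [M0 MD MZ] := sM.
(* Differentiate down to a nonzero constant, by induction on a strict bound [N] for the total degree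
   of the monomials. *)
have M1 : M (mono set0 1).
  have [N fN] : exists N, forall S mm, (f0 S)@_mm != 0 -> (#|S| + mdeg mm < N)%N.
    exists (m + m + \max_S msize (f0 S))%N => S mm; rewrite -mcoeff_msupp => mmS.
    have : (#|S| <= m + m)%N by rewrite -[X in (_ <= X)%N]card_ord max_card.
    have : (mdeg mm < \max_S msize (f0 S))%N.
      by apply: leq_trans (msize_mdeg_lt mmS) (leq_bigmax _).
    by lia.
  elim: N f0 Mf0 f0n fN => [|N IH] f Mf fn fN.
    case/eqP: fn; apply/ffunP=> S; apply/mpolyP=> mm; rewrite ffunE mcoeff0.
    by apply/eqP/negPn/negP => /fN.
  have [[i din]|dE0] := classic (exists i, derE i f != 0).
    apply: (IH (derE i f)) => //; first exact: MdE.
    move=> S mm; rewrite ffunE mcoeff_mderiv => H.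
    have /fN : (f S)@_(mm + U_(i)) != 0 by apply: contraNneq H => ->; rewrite mul0rn.
    by rewrite mdegD mdeg1; lia.
  have [[a dan]|dO0] := classic (exists a, derO a f != 0).
    apply: (IH (derO a f)) => //; first exact: MdO.
    move=> S mm; rewrite ffunE; case: ifP => [|aS]; first by rewrite mcoeff0 eqxx.
    rewrite mcoeffZ mulf_eq0 negb_or => /andP[_ /fN].
    by rewrite cardsU1 aS; lia.
  (* A variable in a monomial of [f] would give a nonzero derivative, so [f] is constant. *)
  have fc S mm : (f S)@_mm != 0 -> S = set0 /\ mm = 0%MM.
    move=> fS; split; apply: NNPP => H.
      have /set0Pn[a aS] : S != set0 by apply/eqP.
      apply: dO0; exists a; apply: contraNneq fS => /ffunP/(_ (S :\ a)).
      rewrite !ffunE setD11 setD1K // => /eqP; rewrite scaler_eq0 signr_eq0 /=.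
      by move/eqP->; rewrite mcoeff0.
    have [i mi] : exists i, (0 < mm i)%N.
      apply: NNPP => H'; apply: H; apply/mnmP => i; rewrite mnm0E.
      by apply/eqP/negPn; rewrite -lt0n; apply/negP => ?; apply: H'; exists i.
    apply: dE0; exists i; apply: contraNneq fS => /ffunP/(_ S).
    rewrite !ffunE => /(congr1 (mcoeff (mm - U_(i))%MM)).
    rewrite mcoeff_mderiv mcoeff0 submK; last by rewrite lep1mP -lt0n.
    by move/eqP; rewrite -mulr_natr mulf_eq0 Num.Theory.pnatr_eq0 orbF.
  have fE : f = (f set0)@_0 *: mono set0 1.
    apply/ffunP=> S; rewrite !ffunE; apply/mpolyP=> mm; rewrite mcoeffZ.
    case: eqP => [->|S0].
      rewrite mcoeff1; case: eqP => [->|mm0]; first by rewrite mulr1.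
      by rewrite mulr0; apply/eqP/negPn/negP => /fc[].
    by rewrite mcoeff0 mulr0; apply/eqP/negPn/negP => /fc[].
  apply: (@subspK _ _ M ((f set0)@_0) _ sM); last by rewrite -fE.
  by apply: contraNneq fn => c0; rewrite fE c0 scale0r.
(* Multiply back up from 1, first by odd and then by even variables; the sign [osign S a] is
   invertible. *)
have MS1 S : M (mono S 1).
  have [N] := ubnP #|S|; elim: N S => // N IH S SN.
  have [->//|/set0Pn[a aS]] := eqVneq S set0.
  apply: (@subspK _ _ M (osign S a) _ sM); first by rewrite signr_eq0.
  have -> : osign S a *: mono S 1 = mulO a (mono (S :\ a) 1).
    apply/ffunP=> T; rewrite !ffunE.
    have [->|TS] := eqVneq T S; first by rewrite aS eqxx.
    rewrite scaler0; case: ifP => // aT; case: eqP => [E|]; last by rewrite scaler0.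
    by rewrite -(setD1K aT) E setD1K // eqxx in TS.
  by apply/MmO/IH; move: SN; rewrite (cardsD1 a) aS; lia.
have MSX S mm : M (mono S 'X_[mm]).
  have [N] := ubnP (mdeg mm); elim: N mm => // N IH mm mmN.
  have [->|] := eqVneq mm 0%MM; first by rewrite mpolyX0.
  move=> mm0; have [i mi] : exists i, (0 < mm i)%N.
    apply: NNPP => H'; case/eqP: mm0; apply/mnmP => i; rewrite mnm0E.
    by apply/eqP/negPn; rewrite -lt0n; apply/negP => ?; apply: H'; exists i.
  have le1 : (U_(i) <= mm)%MM by rewrite lep1mP -lt0n.
  have -> : mono S 'X_[mm] = mulE i (mono S 'X_[mm - U_(i)]).
    apply/ffunP=> T; rewrite !ffunE; case: ifP => _; last by rewrite mulr0.
    by rewrite -mpolyXD addmC submK.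
  by apply/MmE/IH; move: mmN; rewrite -{1}(submK le1) mdegD mdeg1; lia.
move=> f; have -> : f = \sum_S \sum_(mm <- msupp (f S)) (f S)@_mm *: mono S 'X_[mm].
  apply/ffunP=> S; rewrite sum_ffunE (bigD1 S) //= [X in _ + X]big1 => [|T TS].
    rewrite addr0 sum_ffunE {1}(mpolyE (f S)).
    by apply: eq_bigr => mm _; rewrite !ffunE eqxx.
  rewrite sum_ffunE big1 // => mm _.
  by rewrite !ffunE eq_sym (negPf TS) scaler0.
by apply: subsp_sum => // S _ _; apply: subsp_sum => // mm _ _; apply: MZ.
Qed.

End BasicOperators.

(** * The twisted generators as an instance of the oscillator relations *)

Section Twisted.
Variables n m n1 n2 : nat.
Hypothesis n12 : (n1 <= n2)%N.

Definition eidx : finType := (unit + ('I_n + 'I_n))%type.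
Definition idx : finType := (eidx + ('I_m + 'I_m))%type.

Definition evar (e : eidx) : 'I_(n + n).+1 :=
  match e with
  | inl _ => evx0 n
  | inr (inl i) => evx i
  | inr (inr i) => evy i
  end.

Definition ovar (o : 'I_m + 'I_m) : 'I_(m + m) :=
  match o with inl r => odt r | inr r => odv r end.

Definition edual (e : eidx) : eidx :=
  match e with
  | inl _ => inl tt
  | inr (inl i) => inr (inr i)
  | inr (inr i) => inr (inl i)
  end.

Definition odual (o : 'I_m + 'I_m) : 'I_m + 'I_m :=
  match o with inl r => inr r | inr r => inl r end.

Definition dual (a : idx) : idx :=
  match a with inl e => inl (edual e) | inr o => inr (odual o) end.

Definition isodd (a : idx) := if a is inr _ then true else false.

(** The form is skew on odd indices, so the two members of a conjugate pair carry opposite signs. *)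
Definition osgn (o : 'I_m + 'I_m) : CC := if o is inr _ then -1 else 1.
Definition sgn (a : idx) : CC := if a is inr o then osgn o else 1.

Definition twisted (e : eidx) : bool :=
  match e with
  | inl _ => false
  | inr (inl i) => (i < n1)%N
  | inr (inr i) => (n2 <= i)%N
  end.

Notation endo := {linear Bsp n m -> Bsp n m}.

Definition up_e (e : eidx) : endo :=
  if twisted e then (derE (evar e) : endo) else mulE (evar e).
Definition dn_e (e : eidx) : endo :=
  if twisted e then (opneg (mulE (evar e)) : endo) else derE (evar e).
(** Unlike [dn_e], this is already taken along the conjugate variable; the sign for theta comes from
    [osgn] of its conjugate vartheta. *)
Definition dn_o (o : 'I_m + 'I_m) : endo :=
  match o with
  | inl r => opneg (derO (odv r))
  | inr r => derO (odt r)
  end.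

(* [dn a] differentiates along the conjugate variable of [a]. *)
Definition up (a : idx) : endo :=
  match a with inl e => up_e e | inr o => mulO (ovar o) end.
Definition dn (a : idx) : endo :=
  match a with inl e => dn_e (edual e) | inr o => dn_o o end.

Lemma evar_inj : injective evar.
Proof.
clear n12; case=> [[]|[i|i]] [[]|[j|j]] // /(congr1 val) /=; rewrite /bump /= => E;
  try (have := ltn_ord i); try (have := ltn_ord j); try lia;
  by move=> *; do 2 f_equal; apply: val_inj => /=; lia.
Qed.

Lemma ovar_inj : injective ovar.
Proof.
clear n12; case=> i [] j // /(congr1 val) /= E; have := ltn_ord i; have := ltn_ord j;
  try lia; by move=> _ _; congr (_ _); apply: val_inj => /=; lia.
Qed.

Lemma edualK : involutive edual. Proof. by case=> [[]|[]]. Qed.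
Lemma dualK : involutive dual. Proof. by case=> [e|[]] //=; rewrite edualK. Qed.
Lemma isodd_dual a : isodd (dual a) = isodd a. Proof. by case: a. Qed.

Lemma sgn_dual a : sgn (dual a) = sg CC isodd a a * sgn a.
Proof.
by case: a => [e|[r|r]]; rewrite /sg /= ?expr0 ?expr1 ?mulN1r ?opprK ?mul1r.
Qed.

Lemma sgn_sqr a : sgn a * sgn a = 1.
Proof. by case: a => [e|[r|r]] /=; rewrite ?mulrNN mul1r. Qed.

Lemma up_eE e f : up_e e f = if twisted e then derE (evar e) f else mulE (evar e) f.
Proof. by rewrite /up_e; case: ifP. Qed.

Lemma dn_eE e f :
  dn_e e f = if twisted e then - mulE (evar e) f else derE (evar e) f.
Proof. by rewrite /dn_e; case: ifP. Qed.

Lemma dn_oE o f :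
  dn_o o f = if o is inr r then derO (odt r) f else - derO (ovar (odual o)) f.
Proof. by case: o. Qed.

Lemma mulEN i (f : Bsp n m) : mulE i (- f) = - mulE i f.
Proof. exact: linearN. Qed.
Lemma derEN i (f : Bsp n m) : derE i (- f) = - derE i f.
Proof. exact: linearN. Qed.
Lemma mulON a (f : Bsp n m) : mulO a (- f) = - mulO a f.
Proof. exact: linearN. Qed.
Lemma derON a (f : Bsp n m) : derO a (- f) = - derO a f.
Proof. exact: linearN. Qed.
Let opN := (mulEN, derEN, mulON, derON).

Lemma up_e_comm e e' f : up_e e (up_e e' f) = up_e e' (up_e e f).
Proof.
rewrite !up_eE; case te: (twisted e); case te': (twisted e').
- exact: derE_derE.
- rewrite derE_mulE; case: eqP => [/evar_inj E|_]; last by rewrite addr0.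
  by rewrite E te' in te.
- rewrite derE_mulE; case: eqP => [/evar_inj E|_]; last by rewrite addr0.
  by rewrite E te in te'.
- exact: mulE_mulE.
Qed.

Lemma dn_e_comm e e' f : dn_e e (dn_e e' f) = dn_e e' (dn_e e f).
Proof.
rewrite !dn_eE; case te: (twisted e); case te': (twisted e').
- by rewrite !opN mulE_mulE.
- rewrite opN derE_mulE; case: eqP => [/evar_inj E|_]; last by rewrite addr0.
  by rewrite E te in te'.
- rewrite opN derE_mulE; case: eqP => [/evar_inj E|_]; last by rewrite addr0.
  by rewrite E te' in te.
- exact: derE_derE.
Qed.

(** The minus sign in the twist keeps the canonical relation: the commutator of [-x] with the
    derivative in [x] is again 1. *)
Lemma dn_up_e e e' f :
  dn_e e (up_e e' f) = up_e e' (dn_e e f) + (if e == e' then f else 0).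
Proof.
rewrite !dn_eE !up_eE -(inj_eq evar_inj) eq_sym.
case te: (twisted e); case te': (twisted e').
- rewrite opN derE_mulE opprD -addrA.
  by case: eqP; rewrite ?addNr ?oppr0 addr0.
- rewrite opN mulE_mulE; case: eqP => [/evar_inj E|_]; last by rewrite addr0.
  by rewrite E te in te'.
- rewrite derE_derE; case: eqP => [/evar_inj E|_]; last by rewrite addr0.
  by rewrite E te in te'.
- by rewrite derE_mulE eq_sym.
Qed.

Lemma mulO_up_e o e f : mulO o (up_e e f) = up_e e (mulO o f).
Proof. by rewrite !up_eE; case: ifP; rewrite (mulO_mulE, mulO_derE). Qed.

Lemma mulO_dn_e o e f : mulO o (dn_e e f) = dn_e e (mulO o f).
Proof.
by rewrite !dn_eE; case: ifP => _; rewrite ?opN (mulO_mulE, mulO_derE).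
Qed.

Lemma dn_o_up_e o e f : dn_o o (up_e e f) = up_e e (dn_o o f).
Proof.
by rewrite !dn_oE !up_eE; case: o => r; case: ifP => _;
  rewrite (derO_mulE, derO_derE) ?opN.
Qed.

Lemma dn_o_dn_e o e f : dn_o o (dn_e e f) = dn_e e (dn_o o f).
Proof.
by rewrite !dn_oE !dn_eE; case: o => r; case: ifP => _;
  rewrite ?opN (derO_mulE, derO_derE).
Qed.

Lemma dn_o_comm o o' f : dn_o o (dn_o o' f) = - dn_o o' (dn_o o f).
Proof.
by rewrite !dn_oE; case: o => r; case: o' => r'; rewrite ?opN derO_derO ?opprK.
Qed.

Lemma dn_o_mulO o o' f : dn_o o (mulO (ovar o') f) =
  - mulO (ovar o') (dn_o o f) + (if o' == odual o then osgn o' else 0) *: f.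
Proof.
rewrite -(inj_eq ovar_inj) eq_sym !dn_oE.
case: o => r; rewrite derO_mulO ?opN ?opprD ?opprK; congr (_ + _).
  case: eqP => [|_]; last by rewrite scale0r oppr0.
  by case: o' => r' E; rewrite ?scaleN1r //; have := @ovar_inj (inr r) (inl r') E.
case: eqP => [|_]; last by rewrite scale0r.
by case: o' => r' E; rewrite ?scale1r //; have := @ovar_inj (inl r) (inr r') E.
Qed.

Lemma up_comm a b f : up a (up b f) = sg CC isodd a b *: up b (up a f).
Proof.
case: a => [e|o]; case: b => [e'|o']; rewrite /sg /= ?expr0 ?expr1 ?scale1r ?scaleN1r.
- exact: up_e_comm.
- by rewrite mulO_up_e.
- exact: mulO_up_e.
- exact: mulO_mulO.
Qed.

Lemma dn_comm a b f : dn a (dn b f) = sg CC isodd a b *: dn b (dn a f).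
Proof.
case: a => [e|o]; case: b => [e'|o']; rewrite /sg /= ?expr0 ?expr1 ?scale1r ?scaleN1r.
- exact: dn_e_comm.
- by rewrite dn_o_dn_e.
- exact: dn_o_dn_e.
- exact: dn_o_comm.
Qed.

Lemma dn_up a b f :
  dn a (up b f) = sg CC isodd a b *: up b (dn a f) + form dual sgn a b *: f.
Proof.
rewrite /form; case: a => [e|o]; case: b => [e'|o'];
  rewrite /sg /= ?expr0 ?expr1 ?scale1r ?scaleN1r.
- rewrite dn_up_e -[inl _ == _]/(e' == edual e) eq_sym; congr (_ + _).
  by case: eqP; rewrite ?scale1r ?scale0r.
- by rewrite scale0r addr0 mulO_dn_e.
- by rewrite scale0r addr0 dn_o_up_e.
- exact: dn_o_mulO.
Qed.

(** * Identification with [Delta'], [eta'] and the degree *)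

Lemma sum_idx (V : zmodType) (G : idx -> V) : \sum_a G a =
  G (inl (inl tt)) + \sum_i (G (inl (inr (inl i))) + G (inl (inr (inr i))))
  + \sum_r (G (inr (inl r)) + G (inr (inr r))).
Proof.
rewrite !big_sumType !big_split /= (big_pred1 tt) //; by case.
Qed.

Notation Lap' := (Lap dual sgn dn).
Notation Eta' := (Eta dual sgn up).
Notation Eul' := (Eul dual sgn up dn).
Notation Lop' := (Lop isodd up dn).

Lemma sum_by_type (V : zmodType) (A B C : 'I_n -> V) :
  \sum_(i < n | (i < n1)%N) A i + \sum_(i < n | (n1 <= i)%N && (i < n2)%N) B i
    + \sum_(i < n | (n2 <= i)%N) C i =
  \sum_(i < n) if (i < n1)%N then A i else if (i < n2)%N then B i else C i.
Proof.
rewrite (big_mkcond (fun i : 'I_n => (i < n1)%N)).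
rewrite (big_mkcond (fun i : 'I_n => (n1 <= i)%N && (i < n2)%N)).
rewrite (big_mkcond (fun i : 'I_n => (n2 <= i)%N)) -!big_split /=.
apply: eq_bigr => i _; have := n12; case: (ltnP i n1); case: (ltnP i n2) => /=;
  rewrite ?addr0 ?add0r //; lia.
Qed.

(** Every conjugate pair occurs twice in the sum over indices, whence the factor 2 on [Delta]; the
    self-dual index of x_0 occurs once. The three ranges of [i] are the possible twists of the pair
    (x_i, y_i). *)
Lemma Lap_Delta' f : Lap' f = Delta' n1 n2 f.
Proof.
rewrite /Lap sum_idx /Delta' /= scale1r -addrA; congr (_ + _).
rewrite /Delta -!sumrN sum_by_type mulrnDl -!sumrMnl; congr (_ + _).
  apply: eq_bigr => i _; rewrite !scale1r !dn_eE /= (leqNgt n2).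
  have xy : evx i == evy i = false.
    by rewrite (inj_eq evar_inj (inr (inl i)) (inr (inr i))).
  case i1 : (i < n1)%N; first have -> /= : (i < n2)%N by move: i1 n12; lia.
    by rewrite opN derE_mulE eq_sym xy addr0.
  by case i2 : (i < n2)%N; rewrite ?i2 /= ?opN ?derE_mulE ?xy ?addr0 ?(derE_derE (evy i)) ?i2.
by apply: eq_bigr => r _; rewrite scale1r scaleN1r /= /opneg opN opprK (derO_derO (odv r)) opprK.
Qed.

Lemma Eta_eta' f : Eta' f = eta' n1 n2 f.
Proof.
rewrite /Eta sum_idx /eta' /= scale1r -addrA; congr (_ + _).
rewrite /eta sum_by_type mulrnDl -!sumrMnl; congr (_ + _).
  apply: eq_bigr => i _; rewrite !scale1r !up_eE /= (leqNgt n2).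
  have xy : evx i == evy i = false.
    by rewrite (inj_eq evar_inj (inr (inl i)) (inr (inr i))).
  case i1 : (i < n1)%N; first have -> /= : (i < n2)%N by move: i1 n12; lia.
    by rewrite derE_mulE xy addr0.
  case i2 : (i < n2)%N; rewrite ?i2 /=; first by rewrite mulE_mulE.
  by rewrite derE_mulE eq_sym xy addr0.
by apply: eq_bigr => r _; rewrite scale1r scaleN1r /= (mulO_mulO (odv r)) opprK.
Qed.

(** The number of twisted variables: each one lowers the eigenvalue of [Eul] by 1 relative to the
    degree. *)
Definition shift : int :=
  \sum_(i < n) ((i < n1)%N%:Z + (n2 <= i)%N%:Z).

Lemma mcoeff_mulE_derE i (f : Bsp n m) S mm :
  (mulE i (derE i f) S)@_mm = (mm i)%:R * (f S)@_mm.
Proof.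
rewrite !ffunE mulrC; case mi : (mm i) => [|k].
  rewrite mul0r mcoeffM big1 // => -[k1 k2] /= /eqP E.
  rewrite mcoeffX; case: eqP => [E'|]; last by rewrite mulr0.
  by move/mnmP/(_ i): E; rewrite mi mnmDE -E' mnm1E eqxx addn1.
have le1 : (U_(i) <= mm)%MM by rewrite lep1mP mi.
rewrite -{1}(submK le1) addmC mcoeffMX mcoeff_mderiv submK // mnmBE mnm1E eqxx mi.
by rewrite subn1 mulr_natl.
Qed.

(** The eigenvalue of [up_e e \o dn_e e] on a monomial. In the twisted case the derivative acts
    after [-x], hence the successor. *)
Definition weight (mm : 'X_{1.. (n + n).+1}) e : int :=
  if twisted e then - (mm (evar e)).+1%:Z else (mm (evar e))%:Z.

Lemma kdegE (S : {set 'I_(m + m)}) mm : kdeg n1 n2 S mm - shift =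
  (mm (evx0 n))%:Z
  + \sum_(i < n) (weight mm (inr (inl i)) + weight mm (inr (inr i)))
  + \sum_(r < m) ((odt r \in S)%:Z + (odv r \in S)%:Z).
Proof.
have -> : \sum_(r < m) ((odt r \in S)%:Z + (odv r \in S)%:Z) = #|S|%:Z :> int.
  rewrite big_split -sum1_card (big_morph Posz PoszD (erefl _)) [RHS]big_mkcond /=.
  by rewrite big_split_ord; congr (_ + _); apply: eq_bigr => r _; case: ifP.
rewrite /kdeg /shift.
rewrite (big_mkcond (fun i : 'I_n => (n1 <= i)%N)).
rewrite (big_mkcond (fun i : 'I_n => (i < n1)%N)).
rewrite (big_mkcond (fun i : 'I_n => (i < n2)%N)).
rewrite (big_mkcond (fun i : 'I_n => (n2 <= i)%N)) /=.
have -> : \sum_(i < n) (weight mm (inr (inl i)) + weight mm (inr (inr i))) =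
  \sum_(i < n) (if (n1 <= i)%N then (mm (evx i))%:Z else 0)
  - \sum_(i < n) (if (i < n1)%N then (mm (evx i))%:Z else 0)
  + \sum_(i < n) (if (i < n2)%N then (mm (evy i))%:Z else 0)
  - \sum_(i < n) (if (n2 <= i)%N then (mm (evy i))%:Z else 0)
  - \sum_(i < n) ((i < n1)%N%:Z + (n2 <= i)%N%:Z) :> int.
  rewrite -sumrB -big_split -!sumrB; apply: eq_bigr => i _; rewrite /weight /=.
  by case: (leqP n1 i); case: (leqP n2 i); lia.
by ring.
Qed.

Lemma mcoeff_up_dn_e e f (S : {set 'I_(m + m)}) mm :
  (up_e e (dn_e e f) S)@_mm = (weight mm e)%:~R * (f S)@_mm.
Proof.
rewrite up_eE dn_eE /weight; case: (twisted e); last by rewrite mcoeff_mulE_derE.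
rewrite opN derE_mulE eqxx ffunE mcoeffN ffunE mcoeffD mcoeff_mulE_derE.
by rewrite mulrNz -[_.+1%:~R]/(_.+1%:R) -natr1; ring.
Qed.

Lemma mcoeff_up_dn_o o f (S : {set 'I_(m + m)}) mm :
  ((osgn o *: mulO (ovar o) (dn_o (odual o) f)) S)@_mm =
  (ovar o \in S)%:Z%:~R * (f S)@_mm.
Proof.
have mulO_derO a : mulO a (derO a f) S = if a \in S then f S else 0.
  rewrite !ffunE setD11; case: ifP => // aS.
  by rewrite osignD1 // ltnn mul1r scalerA osign_sqr scale1r setD1K.
case: o => r /=; rewrite /opneg ?opN ?scale1r ?scaleN1r ?opprK mulO_derO.
  by case: ifP; rewrite ?mul1r ?mul0r ?mcoeff0.
by case: ifP; rewrite ?mul1r ?mul0r ?mcoeff0.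
Qed.

Lemma mcoeff_Eul f S mm :
  (Eul' f S)@_mm = (kdeg n1 n2 S mm - shift)%:~R * (f S)@_mm.
Proof.
pose phi (g : Bsp n m) := (g S)@_mm; rewrite -/(phi _) -/(phi f).
have phiD g h : phi (g + h) = phi g + phi h by rewrite /phi ffunE mcoeffD.
have phi0 : phi 0 = 0 by rewrite /phi ffunE mcoeff0.
have phiE e : phi (1 *: up_e e (dn_e e f)) = (weight mm e)%:~R * phi f.
  by rewrite scale1r -mcoeff_up_dn_e.
have phiO o : phi (osgn o *: mulO (ovar o) (dn_o (odual o) f)) =
    (ovar o \in S)%:Z%:~R * phi f by rewrite -mcoeff_up_dn_o.
rewrite /Eul sum_idx !phiD !(big_morph phi phiD phi0) kdegE !intrD.
rewrite !(big_morph intr (@intrD _) (erefl _)) !mulrDl !mulr_suml.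
congr (_ + _ + _).
- exact: (phiE (inl tt)).
- apply: eq_bigr => i _; rewrite phiD intrD mulrDl.
  by congr (_ + _); [exact: (phiE (inr (inl i)))|exact: (phiE (inr (inr i)))].
- apply: eq_bigr => r _; rewrite phiD intrD mulrDl.
  by congr (_ + _); [exact: (phiO (inl r))|exact: (phiO (inr r))].
Qed.

(** [Eul'] is diagonal on monomials, and distinct degrees give distinct eigenvalues in
    characteristic zero. *)
Lemma inBk_Eul k f : inBk n1 n2 k f <-> Eul' f = (k - shift)%:~R *: f.
Proof.
split=> [fk | Ef S mm fS].
  apply/ffunP => S; rewrite [RHS]ffunE; apply/mpolyP => mm.
  rewrite mcoeff_Eul mcoeffZ.
  by have [->|/fk ->] := eqVneq (f S)@_mm 0; rewrite ?mulr0.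
have := congr1 (fun g : Bsp n m => (g S)@_mm) Ef.
rewrite mcoeff_Eul ffunE mcoeffZ => /(mulIf fS) /eqP.
by rewrite eqr_int => /eqP; lia.
Qed.

Lemma Hprime_harm k f : Hprime n1 n2 k f <-> harm dual sgn up dn (k - shift) f.
Proof.
by rewrite /Hprime /harm Lap_Delta'; split=> -[/inBk_Eul].
Qed.

Lemma iter_eta' l f : iter l (eta' n1 n2) f = iter l Eta' f.
Proof. by elim: l => //= l ->; rewrite Eta_eta'. Qed.

Lemma sdim_odd : sdim CC isodd = (2 * (n%:Z - m%:Z) + 1)%:~R.
Proof.
rewrite /sdim sum_idx /sg /= !sumr_const !card_ord expr0 expr1.
rewrite -[(1 + 1) *+ n]mulr_natr -[(-1 - 1) *+ m]mulr_natr intrD intrM intrB.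
by ring.
Qed.

(** Twisting only exchanges multiplications with derivations up to sign, so [up] and [dn] still
    generate all of them. *)
Lemma up_dn_irr (M : Bsp n m -> Prop) : subsp M ->
  (forall a f, M f -> M (up a f)) -> (forall a f, M f -> M (dn a f)) ->
  (exists2 f, M f & f != 0) -> forall f, M f.
Proof.
move=> sM Mu Md; have NM f : M (- f) -> M f.
  by move=> /(subspN sM); rewrite opprK.
have evarP i : exists e, i = evar e.
  case: (unliftP ord0 i) => [j ->|->]; last by exists (inl tt).
  by case: (split_ordP j) => k ->; [exists (inr (inl k))|exists (inr (inr k))].
have ovarP a : exists o, a = ovar o.
  by case: (split_ordP a) => k ->; [exists (inl k)|exists (inr k)].
apply: weyl_clifford_irr => //.
- move=> i f Mf; have [e ->] := evarP i; case te: (twisted e).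
    apply: NM; have := Md (inl (edual e)) f Mf.
    by rewrite /= edualK dn_eE te.
  by have := Mu (inl e) f Mf; rewrite /= up_eE te.
- move=> i f Mf; have [e ->] := evarP i; case te: (twisted e).
    by have := Mu (inl e) f Mf; rewrite /= up_eE te.
  by have := Md (inl (edual e)) f Mf; rewrite /= edualK dn_eE te.
- by move=> a f Mf; have [o ->] := ovarP a; exact: (Mu (inr o)).
- move=> a f Mf; have [[r|r] ->] := ovarP a; first exact: (Md (inr (inr r))).
  by apply: NM; exact: (Md (inr (inl r))).
Qed.

(** * The osp generators as operators L_ab *)

Definition gen_sign (g : ospgen n m) : CC :=
  match g with Gtv _ _ | Gxv _ _ | G0v _ => -1 | _ => 1 end.

(** The second index is conjugate to the variable differentiated in the first term of the generator.
    [gen_sign] is -1 exactly when that variable is a vartheta, since [dn] of theta is minus the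
    derivative in vartheta. *)
Definition gen_pair (g : ospgen n m) : idx * idx :=
  let x i : idx := inl (inr (inl i)) in let y i : idx := inl (inr (inr i)) in
  let t r : idx := inr (inl r) in let v r : idx := inr (inr r) in
  let o : idx := inl (inl tt) in
  match g with
  | Gxx i j => (x i, y j) | Gtt r s => (t r, v s)
  | Gxt i r => (x i, v r) | Gtx i r => (t r, y i)
  | Gxy i j => (x i, x j) | Gyx i j => (y i, y j)
  | Gvt r s => (v r, v s) | Gtv r s => (t r, t s)
  | Gxv i r => (x i, t r) | Gyt i r => (y i, v r)
  | G0x i => (o, y i) | G0y i => (o, x i)
  | G0t r => (o, v r) | G0v r => (o, t r)
  end.

Lemma sigma_rho_Lop g f :
  sigma_rho n1 n2 g f = gen_sign g *: Lop' (gen_pair g).1 (gen_pair g).2 f.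
Proof.
have ux (i : 'I_n) : (if (i < n1)%N then derE (evx i) else mulE (evx i)) =
    up_e (inr (inl i)) :> op n m by rewrite /up_e /=; case: ifP.
have uy (i : 'I_n) : (if (n2 <= i)%N then derE (evy i) else mulE (evy i)) =
    up_e (inr (inr i)) :> op n m by rewrite /up_e /=; case: ifP.
have dx (i : 'I_n) : (if (i < n1)%N then opneg (mulE (evx i)) else derE (evx i)) =
    dn_e (inr (inl i)) :> op n m by rewrite /dn_e /=; case: ifP.
have dy (i : 'I_n) : (if (n2 <= i)%N then opneg (mulE (evy i)) else derE (evy i)) =
    dn_e (inr (inr i)) :> op n m by rewrite /dn_e /=; case: ifP.
have upd a r : up a (dn (inr (inl r)) f) = - up a (derO (odv r) f).
  exact: linearN.
rewrite /sigma_rho /rho_gen; case: g => [i j|r s|i r|r i|i j|i j|r s|r s|i r|i r|i|i|r|r];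
  rewrite /opsub /opadd /comp ?(ux, uy, dx, dy) /Lop /sg /gen_sign /gen_pair /fst /snd
    /isodd /andb ?expr0 ?expr1 ?scale1r ?scaleN1r.
all: by rewrite ?upd ?opprK ?opprD ?opprK.
Qed.

End Twisted.

(** * Submodules for the concrete representation *)

Section Modules.
Variables n m n1 n2 : nat.
Hypothesis n12 : (n1 <= n2)%N.

Notation up' := (@up n m n1 n2).
Notation dn' := (@dn n m n1 n2).
Notation dual' := (@dual n m).
Notation sgn' := (@sgn n m).
Notation isodd' := (@isodd n m).
Notation act := (@sigma_rho n m n1 n2).
Notation Lop' := (Lop isodd' up' dn').
Notation Eta' := (Eta dual' sgn' up').
Notation harm' := (harm dual' sgn' up' dn').
Notation shift' := (@shift n n1 n2).

(** The generators cover each pair of indices in one order; the other order follows by [Lop_swap].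
    Even diagonal pairs give 0, while odd ones are generators with [r = s]. *)
Lemma submodule_Lop (N : Bsp n m -> Prop) : submodule act N ->
  forall a b f, N f -> N (Lop' a b f).
Proof.
move=> [sN Nact]; have [N0 ND NZ] := sN.
have gen g f : ospgen_ok g -> N f -> N (Lop' (gen_pair g).1 (gen_pair g).2 f).
  move=> gok Nf; apply: (@subspK _ _ N (gen_sign g) _ sN).
    by case: g {gok} => *; rewrite /= ?oppr_eq0 oner_eq0.
  by rewrite -sigma_rho_Lop; apply: Nact.
have swap a b f : N (Lop' b a f) -> N (Lop' a b f).
  by rewrite (Lop_swap _ _ _ b a) => H; apply: subspN => //; apply: NZ.
have diag e f : N (Lop' (inl e) (inl e) f).
  by rewrite /Lop /sg /= expr0 scale1r subrr.
move=> [[[]|[i|i]]|[r|r]] [[[]|[j|j]]|[s|s]] f Nf.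
- exact: diag.
- exact: (gen (G0y m j) f isT Nf).
- exact: (gen (G0x m j) f isT Nf).
- exact: (gen (G0v n s) f isT Nf).
- exact: (gen (G0t n s) f isT Nf).
- exact: swap (gen (G0y m i) f isT Nf).
- case: (ltngtP i j) => [ij|ji|/val_inj ->]; last exact: diag.
    exact: (gen (Gxy m i j) f ij Nf).
  exact: swap (gen (Gxy m j i) f ji Nf).
- exact: (gen (Gxx m i j) f isT Nf).
- exact: (gen (Gxv i s) f isT Nf).
- exact: (gen (Gxt i s) f isT Nf).
- exact: swap (gen (G0x m i) f isT Nf).
- exact: swap (gen (Gxx m j i) f isT Nf).
- case: (ltngtP i j) => [ij|ji|/val_inj ->]; last exact: diag.
    exact: (gen (Gyx m i j) f ij Nf).
  exact: swap (gen (Gyx m j i) f ji Nf).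
- exact: swap (gen (Gtx i s) f isT Nf).
- exact: (gen (Gyt i s) f isT Nf).
- exact: swap (gen (G0v n r) f isT Nf).
- exact: swap (gen (Gxv j r) f isT Nf).
- exact: (gen (Gtx j r) f isT Nf).
- case: (leqP r s) => [rs|/ltnW sr]; first exact: (gen (Gtv n r s) f rs Nf).
  exact: swap (gen (Gtv n s r) f sr Nf).
- exact: (gen (Gtt n r s) f isT Nf).
- exact: swap (gen (G0t n r) f isT Nf).
- exact: swap (gen (Gxt j r) f isT Nf).
- exact: swap (gen (Gyt j r) f isT Nf).
- exact: swap (gen (Gtt n s r) f isT Nf).
- case: (leqP r s) => [rs|/ltnW sr]; first exact: (gen (Gvt n r s) f rs Nf).
  exact: swap (gen (Gvt n s r) f sr Nf).
Qed.

Lemma Lop_act_closed (N : Bsp n m -> Prop) : subsp N ->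
  (forall a b f, N f -> N (Lop' a b f)) -> submodule act N.
Proof.
move=> sN NL; split=> [|g _ f Nf]; first by case: sN.
by rewrite sigma_rho_Lop //; case: sN => _ _; apply; apply: NL.
Qed.

(** * Powers of one variable as explicit harmonic vectors *)

Definition hwv (p : 'I_n) (t : nat) : Bsp n m := mono set0 'X_[U_(evx p) *+ t].

Lemma derE_hwv (p : 'I_n) t i : i != evx p -> derE i (hwv p t) = 0.
Proof.
move=> ip; apply/ffunP => S; rewrite !ffunE; case: ifP => _; last exact: linear0.
by rewrite mderivX mulmnE mnm1E eq_sym (negPf ip) scale0r.
Qed.

Lemma derO_hwv (p : 'I_n) t a : derO a (hwv p t) = 0.
Proof.
apply/ffunP => S; rewrite !ffunE; case: ifP => // aS.
by case: eqP => [/setP/(_ a)|]; rewrite ?scaler0 // !inE eqxx.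
Qed.

Lemma hwv_neq0 (p : 'I_n) t : hwv p t != 0.
Proof.
apply/eqP => /ffunP/(_ set0); rewrite !ffunE eqxx => /(congr1 (mcoeff (U_(evx p) *+ t)%MM)).
by rewrite mcoeffX eqxx mcoeff0 => /eqP; rewrite oner_eq0.
Qed.

(** Every term of [Delta'] contains a derivative in x_0, some y_i, an odd variable, or x_s with
    index at least [n2]; all of them kill a power of x_p. *)
Lemma Hprime_hwv (p : 'I_n) t : (p < n2)%N ->
  Hprime n1 n2 (if (p < n1)%N then - t%:Z else t%:Z) (hwv p t).
Proof.
move=> pn2; have neq e : e != inr (inl p) -> @evar n e != evx p.
  by rewrite -(inj_eq (@evar_inj n)).
split=> [S mm|].
  rewrite ffunE; case: ifP => [/eqP -> {S}|]; last by rewrite mcoeff0 eqxx.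
  rewrite mcoeffX; case: (_ =P mm) => [<- _|]; last by rewrite eqxx.
  have mmE e : (U_(evx p) *+ t)%MM (@evar n e) = if e == inr (inl p) then t else 0%N.
    rewrite mulmnE mnm1E; case: (e =P _) => [->|/eqP/neq ne].
      by rewrite eqxx mul1n.
    by rewrite eq_sym (negPf ne) mul0n.
  have sumx (P : pred 'I_n) : \sum_(r < n | P r) ((U_(evx p) *+ t)%MM (evx r))%:Z =
      if P p then t%:Z else 0.
    have -> : \sum_(r < n | P r) ((U_(evx p) *+ t)%MM (evx r))%:Z =
        \sum_(r < n | P r) if r == p then t%:Z else 0.
      by apply: eq_bigr => r _; rewrite (mmE (inr (inl r))) (fun_if Posz).
    case Pp: (P p); first by rewrite (bigD1 p) //= eqxx big1 ?addr0 // => r /andP[_ /negPf ->].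
    by rewrite big1 // => r; case: eqP => // ->; rewrite Pp.
  have sumy (P : pred 'I_n) : \sum_(r < n | P r) ((U_(evx p) *+ t)%MM (evy r))%:Z = 0.
    by rewrite big1 // => r _; rewrite (mmE (inr (inr r))).
  rewrite /kdeg !sumx !sumy (mmE (inl tt)) cards0 (leqNgt n1) /=.
  by case: (p < n1)%N => /=; lia.
have derE0 i : derE i 0 = 0 :> Bsp n m by exact: linear0.
have mulE0 i : mulE i 0 = 0 :> Bsp n m by exact: linear0.
have derO0 a : derO a 0 = 0 :> Bsp n m by exact: linear0.
have dy i : derE (evy i) (hwv p t) = 0 by rewrite derE_hwv // (neq (inr (inr i))).
have d0 : derE (evx0 n) (hwv p t) = 0 by exact: derE_hwv (neq (inl tt) isT).
have dx (i : 'I_n) : (n2 <= i)%N -> derE (evx i) (hwv p t) = 0.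
  move=> n2i; apply: derE_hwv; apply: (neq (inr (inl i))).
  by apply: contraTneq n2i => -[->]; rewrite -ltnNge.
have dO a := derO_hwv p t a.
move: (hwv p t) d0 dx dy dO => h d0 dx dy dO.
have z1 : \sum_(i < n | (i < n1)%N) mulE (evx i) (derE (evy i) h) = 0.
  by rewrite big1 // => i _; rewrite dy mulE0.
have z2 : \sum_(i < n | (n1 <= i)%N && (i < n2)%N) derE (evx i) (derE (evy i) h) = 0.
  by rewrite big1 // => i _; rewrite dy derE0.
have z3 : \sum_(i < n | (n2 <= i)%N) mulE (evy i) (derE (evx i) h) = 0.
  by rewrite big1 // => i n2i; rewrite dx // mulE0.
have z4 : \sum_(r < m) derO (odt r) (derO (odv r) h) = 0.
  by rewrite big1 // => r _; rewrite dO derO0.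
by rewrite /Delta' /Delta d0 derE0 z1 z2 z3 z4 oppr0 !addr0 mul0rn addr0.
Qed.

(** * Irreducible summands and the direct sum *)

Let duK := @dualK n m.
Let p_du := @isodd_dual n m.
Let s_du := @sgn_dual n m.
Let s_sqr := @sgn_sqr n m.
Let uu := @up_comm n m n1 n2.
Let dd := @dn_comm n m n1 n2.
Let ud := @dn_up n m n1 n2.
Let odd := @sdim_odd n m.
Let irr := @up_dn_irr n m n1 n2.

Lemma etaH_etaV l k g :
  etaH n1 n2 l k g <-> etaV dual' sgn' up' harm' (l, k - shift') g.
Proof.
split=> [[f [/(Hprime_harm n12) hf ->]]|[f hf ->]].
  by exists f => //; rewrite (iter_eta' n12).
by exists f; split; [apply/(Hprime_harm n12)|rewrite (iter_eta' n12)].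
Qed.

Lemma etaH_irreducible (p : 'I_n) t l k :
  Hprime n1 n2 k (hwv p t) -> irreducible act (etaH n1 n2 l k).
Proof.
move=> /(Hprime_harm n12) hp.
have [V0 VD VZ] := @etaV_subsp _ _ _ dual' sgn' up' harm' (l, k - shift')
      (harm_subsp dual' sgn' up' dn' (k - shift')).
split.
- apply: Lop_act_closed; first split.
  + by apply/etaH_etaV; exact: V0.
  + move=> f g /etaH_etaV Vf /etaH_etaV Vg; apply/etaH_etaV; exact: VD Vf Vg.
  + move=> c f /etaH_etaV Vf; apply/etaH_etaV; exact: VZ Vf.
  + move=> a b f /etaH_etaV Vf; apply/etaH_etaV.
    exact: (etaV_Lop duK p_du s_du s_sqr uu dd ud).
- exists (iter l Eta' (hwv p t)); split; first by apply/etaH_etaV; exists (hwv p t).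
  move=> /(iter_Eta_eq0 duK p_du s_du s_sqr uu ud odd hp) h0.
  by have := hwv_neq0 p t; rewrite h0 eqxx.
- move=> N NS NM; have NL := submodule_Lop NS; have [sN _] := NS.
  have NV f (Nf : N f) := (etaH_etaV l k f).1 (NM f Nf).
  have [z|all] := etaV_harm_irr duK p_du s_du s_sqr uu dd ud odd irr sN NL NV.
    by left.
  by right=> f /etaH_etaV /all.
Qed.

Lemma etaH_direct_sum (p : 'I_n) t k0 : Hprime n1 n2 k0 (hwv p t) ->
  direct_sum_decomp (fun lk : nat * int => etaH (n := n) (m := m) n1 n2 lk.1 lk.2).
Proof.
move=> /(Hprime_harm n12) hp; split=> [f|s g us Vg sum0 i si].
  have [r Vr ->] := harm_spanV duK p_du s_du s_sqr uu dd ud odd irr hp (hwv_neq0 p t) f.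
  (* Spanning terms may share a label, so they are grouped by label; adding [shift'] turns the [Eul]
     eigenvalue back into the degree. *)
  pose ix (q : (nat * int) * Bsp n m) := (q.1.1, q.1.2 + shift').
  exists (undup (map ix r)), (fun i => \sum_(q <- r | ix q == i) q.2); split.
    move=> [l k] _.
    have sV := @etaV_subsp _ _ _ dual' sgn' up' harm' (l, k - shift')
      (harm_subsp dual' sgn' up' dn' (k - shift')).
    apply/etaH_etaV; apply: (subsp_sum sV) => q rq /eqP[<- <-].
    rewrite addrK -surjective_pairing; exact: Vr.
  rewrite (exchange_big_dep xpredT) //= big_seq [RHS]big_seq.
  apply: eq_bigr => q rq; rewrite -big_filter.
  have qs : ix q \in undup (map ix r) by rewrite mem_undup; apply: map_f.
  have -> : [seq i <- undup (map ix r) | ix q == i] = [:: ix q].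
    rewrite -(filter_pred1_uniq (undup_uniq _) qs).
    by apply: eq_filter => i; apply: eq_sym.
  by rewrite big_seq1.
pose ix (lk : nat * int) := (lk.1, lk.2 - shift').
(* The component [g i] plays the part of [g0], and the other members of [s] avoid its label by
   uniqueness. *)
apply: (etaV_indep duK p_du s_du s_sqr uu ud odd (r := rem i s) (ix := ix) (g := g)
  (i := ix i)).
- by apply/etaH_etaV/Vg.
- move=> j; rewrite mem_rem_uniq // !inE => /andP[ji sj]; split.
    by apply/etaH_etaV/Vg.
  by apply: contra_neq ji; case: j i {si sj Vg us} => [l k] [l' k'] [-> /addIr ->].
- by rewrite -[RHS]sum0 (big_rem i si) /=.
Qed.

End Modules.

Theorem theorem5p2 (n m n1 n2 : nat) :
  (0 < n)%N -> (0 < m)%N -> (1 <= n1)%N -> (n1 + 1 < n2)%N -> (n2 <= n)%N ->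
  (forall k : int, irreducible (@sigma_rho n m n1 n2) (Hprime n1 n2 k)) /\
  (forall (l : nat) (k : int), irreducible (@sigma_rho n m n1 n2) (etaH n1 n2 l k)) /\
  direct_sum_decomp (fun lk : nat * int => etaH (n := n) (m := m) n1 n2 lk.1 lk.2).
Proof.
move=> n0 _ n1_gt0 n1n2 n2n; have n12 : (n1 <= n2)%N by lia.
(* Degree [k >= 0] is reached by a power of the untwisted x_(n1+1), which has 0-based index [n1],
   and negative degree by a power of the twisted x_1. [Negz t] stands for [-(t+1)], hence the
   exponent [t.+1]. *)
have wit k : exists (p : 'I_n) t, Hprime n1 n2 k (hwv m p t).
  have n1n : (n1 < n)%N by lia.
  case: k => t.
    exists (Ordinal n1n), t; have := @Hprime_hwv n m n1 n2 n12 (Ordinal n1n) t.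
    by rewrite /= ltnn; apply; lia.
  exists (Ordinal n0), t.+1; have := @Hprime_hwv n m n1 n2 n12 (Ordinal n0) t.+1.
  by rewrite /= n1_gt0 NegzE; apply; lia.
have irr l k : irreducible (@sigma_rho n m n1 n2) (etaH n1 n2 l k).
  by have [p [t H]] := wit k; apply: etaH_irreducible H.
split; last by split=> //; have [p [t H]] := wit 0; apply: etaH_direct_sum H.
(* The first claim is the case [l = 0], where no power of [eta'] is applied. *)
move=> k; have [[[S0 SD SZ] act_closed] [f [ef f0]] min] := irr 0%N k.
have E (f' : Bsp n m) : etaH n1 n2 0 k f' <-> Hprime n1 n2 k f'.
  by split=> [[h [hh ->]]|hh]; [|exists f'].
split.
- split; first split.
  + exact/E.
  + by move=> f1 f2 /E h1 /E h2; apply/E/SD.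
  + by move=> c f1 /E h1; apply/E/SZ.
  + by move=> g ok f1 /E h1; apply/E/act_closed.
- by exists f; split=> //; apply/E.
- move=> N sN NH; have [z|all] := min N sN (fun f' Nf => (E f').2 (NH f' Nf)).
    by left.
  by right=> f' /E /all.
Qed.
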